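(* Let $L>0$ and $\alpha>0$ be fixed and consider $\tau>0$ and $\omega>0$. Set $$\mathcal{Y}_\tau=\left\{u\in\mathbb{H}^1_{per,even}:\ \int_0^L|u|^{\alpha+2}\,dx=\tau\right\},\qquad \mathcal{B}_\omega(u)=\frac12\int_0^L \left(|u_x|^2+\omega|u|^2\right)dx .$$ The minimization problem $$\Gamma_\omega:=\inf_{u\in\mathcal{Y}_\tau}\mathcal{B}_\omega(u)$$ has at least one solution, that is, there exists a complex-valued function $\Phi\in\mathcal{Y}_\tau$ such that $\mathcal{B}_\omega(\Phi)=\Gamma_\omega$. Moreover, $\Phi$ satisfies the equation $$-\Phi''+\omega\Phi-|\Phi|^\alpha\Phi=0 .$$
   Context: $H^1_{per}=H^1_{per}(\mathbb{T}_L)$ is the Sobolev space of real-valued $L$-periodic functions, $\mathbb{H}^1_{per}=H^1_{per}\times H^1_{per}$, where a pair $(f_1,f_2)$ is identified with the complex-valued function $f_1+if_2$, and $\mathbb{H}^1_{per,even}$ is the subspace of even functions in $\mathbb{H}^1_{per}$. $|\cdot|$ is the complex modulus.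
   Formalization: The equation as printed holds for a minimizer Φ in Y_τ only at one level τ=τ0(L,α,ω), since it forces 2Γ_ω=τ; proved instead: a minimizer exists for every τ>0, each minimizer solves the equation after scaling by some c>0 (cΦ minimizes at level c^{α+2}τ), and unscaled exactly when τ=τ0. *)

(* Defs.v *)
From HB Require Import structures.
From mathcomp Require Import all_boot all_order all_algebra.
From mathcomp Require Import all_classical all_reals all_analysis.
From mathcomp Require Import complex.

Set Implicit Arguments.
Unset Strict Implicit.
Unset Printing Implicit Defensive.

Import Order.TTheory GRing.Theory Num.Theory.
Import numFieldNormedType.Exports.
Import ComplexField.Normc.

Local Open Scope classical_set_scope.
Local Open Scope ring_scope.
Local Open Scope complex_scope.

(* Conventions. Functions on the torus T_L are L-periodic functions on R, and
   an element of a Sobolev space is given by any representative of its class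
   modulo equality almost everywhere: among L-periodic functions, the
   predicates [H1per], [HH1per], [HH1per_even], [Y] and the value of [B] do not
   depend on the representative. *)

Section PeriodicSobolev.
Context {R : realType}.
Implicit Types (L : R) (f g phi : R -> R).

Notation mu := (@lebesgue_measure R).

Definition L2per L f :=
  measurable_fun `[0, L] f /\
  mu.-integrable `[0, L] (EFin \o (fun x => f x ^+ 2)).

(* As usual, C^1 and C^oo test functions give the same notion of weak
   derivative on the torus. *)
Definition testC1per L phi :=
  [/\ periodic phi L, forall x, derivable phi x 1 & continuous (derive1 phi)].

Definition is_wderiv L f g :=
  L2per L g /\
  forall phi, testC1per L phi ->
    (\int[mu]_(x in `[0%R, L]) (f x * derive1 phi x) =
     - \int[mu]_(x in `[0%R, L]) (g x * phi x))%R.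

Definition H1per L f :=
  [/\ periodic f L, L2per L f & exists g, is_wderiv L f g].

(* A choice of weak derivative; it is unique almost everywhere on [0, L]. *)
Definition wderiv L f : R -> R := get [set g | is_wderiv L f g].

End PeriodicSobolev.

Section ComplexValued.
Context {R : realType}.
Implicit Types (L alpha omega tau : R) (u : R -> R[i]).

Notation mu := (@lebesgue_measure R).

Definition re_part u : R -> R := fun x => complex.Re (u x).
Definition im_part u : R -> R := fun x => complex.Im (u x).

Definition HH1per L u := H1per L (re_part u) /\ H1per L (im_part u).

Definition HH1per_even L u :=
  HH1per L u /\ {ae mu, forall x, u (- x) = u x}.

Definition cwderiv L u : R -> R[i] :=
  fun x => wderiv L (re_part u) x +i* wderiv L (im_part u) x.

Definition Y L alpha tau : set (R -> R[i]) :=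
  [set u | HH1per_even L u /\
           (\int[mu]_(x in `[0%R, L]) (normc (u x) `^ (alpha + 2)) = tau)%R].

Definition B L omega u : R :=
  2^-1 * (\int[mu]_(x in `[0%R, L])
            (normc (cwderiv L u x) ^+ 2 + omega * normc (u x) ^+ 2))%R.

(* [inf] is the genuine infimum here: for 0 < L and 0 < tau the set [Y] contains
   a constant function, and for 0 <= omega the values of [B] are nonnegative. *)
Definition Gamma L alpha tau omega : R := inf (B L omega @` Y L alpha tau).

Definition is_minimizer L alpha tau omega u :=
  Y L alpha tau u /\ B L omega u = Gamma L alpha tau omega.

Definition cderivable u :=
  forall x, derivable (re_part u) x 1 /\ derivable (im_part u) x 1.

Definition cderiv u : R -> R[i] :=
  fun x => derive1 (re_part u) x +i* derive1 (im_part u) x.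

(* [u] is, as a class modulo equality almost everywhere, a classical solution
   of - u'' + omega u - |u|^alpha u = 0 on the whole line. A minimizer on
   [Y L alpha tau] satisfies - u'' + omega u - kappa |u|^alpha u = 0 with the
   Lagrange multiplier kappa = 2 Gamma / tau; since Gamma is homogeneous of
   degree 2 / (alpha + 2) in tau, kappa = 1 holds for a single tau, and for the
   other values the equation holds after the scaling u |-> kappa^(1/alpha) u. *)
Definition solves alpha omega u :=
  exists v : R -> R[i],
    [/\ {ae mu, forall x, u x = v x},
        cderivable v, cderivable (cderiv v) &
        forall x, - cderiv (cderiv v) x + omega%:C * v x
                  - (normc (v x) `^ alpha)%:C * v x = 0].

End ComplexValued.

(* Main.v *)
Require Import Defs.
From HB Require Import structures.
From mathcomp Require Import all_boot all_order all_algebra.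
From mathcomp Require Import all_classical all_reals all_analysis.
From mathcomp Require Import complex.
From mathcomp Require Import measurable_realfun.
From mathcomp Require Import ring lra.
Import Order.TTheory GRing.Theory Num.Theory.
Import numFieldNormedType.Exports.
Local Open Scope ring_scope.
Local Open Scope complex_scope.

Set Implicit Arguments.
Unset Strict Implicit.
Unset Printing Implicit Defensive.

(** A complex-valued function is handled through its real and imaginary parts,
    a family [F : bool -> R -> R]. The constraint is then [mass F], the
    integral of [cmod F x `^ p] with [p = alpha + 2], and the functional is the
    quadratic form [energy F G], where [G] is any weak derivative of [F].

    Existence. By du Bois-Reymond ([wderiv_rep]) a function with a weak
    derivative [g] is almost everywhere [C + prim g], so a bound on the energy
    makes a minimizing sequence uniformly bounded and uniformly Hoelder of
    exponent 1/2 ([sup_bound], [prim_hoelder]), and a subsequence converges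
    uniformly ([ascoli]). The derivatives converge strongly: the midpoint
    of two late terms nearly satisfies the constraint, hence by homogeneity its
    energy is not much below the infimum, and the parallelogram identity makes
    the energy of the difference small ([near_minimizers_close]). Completeness of L^2 gives the minimizer
    ([exists_minimizer]).

    Equation. Homogeneity replaces the constrained problem by the inequality
    [q ^+ 2 * min_energy tau <= energy F G], valid as soon as
    [q `^ p * tau <= mass F] ([min_energy_homog]). Convexity of [z |-> |z|^p]
    bounds the mass of [F + t F'] from below by its first-order expansion
    ([mass_tangent]). With [q ^ p] equal to that expansion divided by [tau] the
    inequality becomes one between two functions of [t] that agree at [0], and
    equating their slopes ([minimizer_variation]) yields the weak form of
    [- u'' + omega u - kappa |u|^alpha u = 0] with [kappa = 2 Gamma / tau],
    first against even test functions and then, by symmetry, against all of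
    them ([minimizer_weak_eq]). The equation itself improves regularity: the
    continuous representative is of class C^2 ([regularity]).

    Multiplier. Since [Gamma] is homogeneous of degree [2 / p] in [tau], the
    multiplier [2 Gamma / tau] is a decreasing power of [tau] and is one at
    exactly one [tau0] ([multiplier_one]). A positive multiple of a minimizer is
    a minimizer at another level, and the multiple at level [tau0] solves the
    equation with [kappa = 1]. Conversely, subtracting the equation with
    [kappa = 1] from the one with [kappa] gives [(kappa - 1) |u|^alpha u = 0],
    which for a nonzero [u] forces [kappa = 1] ([solves_multiplier]). *)


(** * Integrable and square-integrable functions on a period *)

Section Toolkit.
Context {R : realType}.
Local Open Scope classical_set_scope.
Notation mu := (@lebesgue_measure R).
Implicit Types (L c M : R) (f g h : R -> R).

Definition L1per L f := mu.-integrable `[0, L] (EFin \o f).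

Definition ip L f g := \int[mu]_(x in `[0, L]) (f x * g x).

(** Membership is a hypothesis, as in the almost everywhere side conditions of
    integration lemmas over [`[0, L]]. *)
Definition ae_on L (P : R -> Prop) := {ae mu, forall x, `[0, L] x -> P x}.

Lemma measurable_period L : measurable (`[0, L] : set R). Proof. exact: measurable_itv. Qed.
#[local] Hint Resolve measurable_period : core.

Lemma ae_mono (P Q : R -> Prop) : (forall x, P x -> Q x) ->
  {ae mu, forall x, P x} -> {ae mu, forall x, Q x}.
Proof. by move=> PQ; apply: filterS PQ; exact: (ae_filter_ringOfSetsType mu). Qed.

Lemma ae_mono2 (P Q S : R -> Prop) : (forall x, P x -> Q x -> S x) ->
  {ae mu, forall x, P x} -> {ae mu, forall x, Q x} -> {ae mu, forall x, S x}.
Proof. by move=> PQ; apply: filterS2 PQ; exact: (ae_filter_ringOfSetsType mu). Qed.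

Lemma period_lty L : (mu `[0%R, L] < +oo)%E.
Proof. by rewrite lebesgue_measure_itv; case: ifPn; rewrite ?ltry//= lte_fin. Qed.

Lemma L1per_meas L f : L1per L f -> measurable_fun `[0, L] f.
Proof. by move=> /integrableP[/measurable_EFinP]. Qed.

Lemma L1perD L f g : L1per L f -> L1per L g -> L1per L (fun x => f x + g x).
Proof. by move=> lf lg; apply: (integrableD _ lf lg). Qed.

Lemma L1perZ L c f : L1per L f -> L1per L (fun x => c * f x).
Proof. by move=> lf; apply: (integrableZl _ _ lf). Qed.

Lemma L1perB L f g : L1per L f -> L1per L g -> L1per L (fun x => f x - g x).
Proof. by move=> lf lg; apply: (integrableB _ lf lg). Qed.

Lemma L1per_le L f h : measurable_fun `[0, L] f -> L1per L h ->
  ae_on L (fun x => `|f x| <= h x) -> L1per L f.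
Proof.
move=> mf /integrableP[mh hoo] fh; apply/integrableP; split.
  exact/measurable_EFinP.
apply: le_lt_trans hoo; apply: ae_ge0_le_integral => //.
- by apply: measurableT_comp => //; exact/measurable_EFinP.
- by apply: measurableT_comp => //; exact/measurable_EFinP.
- apply: (ae_mono _ fh) => x /= fhx Dx; rewrite lee_fin.
  by apply: (le_trans (fhx Dx)); exact: ler_norm.
Qed.

Lemma L1per_cst L c : L1per L (fun=> c).
Proof.
apply: measurable_bounded_integrable => //; first exact: period_lty.
by exists `|c|; split => // x xc y _; exact: ltW.
Qed.

Lemma L1per_bounded L f M : measurable_fun `[0, L] f ->
  ae_on L (fun x => `|f x| <= M) -> L1per L f.
Proof. by move=> mf fM; apply: (L1per_le mf (L1per_cst L M)). Qed.

Lemma L2per_L1perM L f g : L2per L f -> L2per L g ->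
  L1per L (fun x => f x * g x).
Proof.
move=> [mf f2] [mg g2]; apply: (@L1per_le _ _ (fun x => f x ^+ 2 + g x ^+ 2)).
- exact: measurable_funM.
- exact: L1perD.
- apply: aeW => x Dx; rewrite normrM -(real_normK (num_real (f x))) -(real_normK (num_real (g x))).
  move: `|f x| `|g x| (normr_ge0 (f x)) (normr_ge0 (g x)) => a b a0 b0.
  have := sqr_ge0 (a - b); nra.
Qed.

Lemma L2per_cst L c : L2per L (fun=> c).
Proof. by split => //; exact: (L1per_cst L (c ^+ 2)). Qed.

Lemma L2per_L1per L f : L2per L f -> L1per L f.
Proof.
move=> lf; have := L2per_L1perM (L2per_cst L 1) lf.
by apply: eq_integrable => // x _ /=; rewrite mul1r.
Qed.

Lemma L2per_meas L f : L2per L f -> measurable_fun `[0, L] f. Proof. by case. Qed.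

Lemma L2perZ L c f : L2per L f -> L2per L (fun x => c * f x).
Proof.
move=> [mf f2]; split; first exact: measurable_funM.
have := L1perZ (c ^+ 2) f2.
by apply: eq_integrable => // x _ /=; rewrite exprMn.
Qed.

Lemma L2perD L f g : L2per L f -> L2per L g -> L2per L (fun x => f x + g x).
Proof.
move=> lf lg; split; first by apply: measurable_funD; apply: L2per_meas.
have := L1perD (L1perD lf.2 (L1perZ 2 (L2per_L1perM lf lg))) lg.2.
by apply: eq_integrable => // x _ /=; congr EFin; ring.
Qed.

Lemma L2perB L f g : L2per L f -> L2per L g -> L2per L (fun x => f x - g x).
Proof.
move=> lf lg; have := L2perD lf (L2perZ (-1) lg).
by under eq_fun do rewrite mulN1r.
Qed.

Lemma L2per_bounded L f M : measurable_fun `[0, L] f ->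
  ae_on L (fun x => `|f x| <= M) -> L2per L f.
Proof.
move=> mf fM; split => //; apply: (@L1per_bounded _ _ (M ^+ 2)).
  exact: measurable_funX.
apply: (ae_mono _ fM) => x /= fMx /fMx{}fMx.
by rewrite normrX lerXn2r // nnegrE ?(le_trans _ fMx).
Qed.

Lemma ae_on_mono L (P Q : R -> Prop) : (forall x, 0 <= x <= L -> P x -> Q x) ->
  ae_on L P -> ae_on L Q.
Proof.
by move=> PQ; apply: ae_mono => x Px Dx; apply: PQ; [move: Dx; rewrite /= in_itv|exact: Px].
Qed.

Lemma ae_on_mono2 L (P Q S : R -> Prop) : (forall x, 0 <= x <= L -> P x -> Q x -> S x) ->
  ae_on L P -> ae_on L Q -> ae_on L S.
Proof.
move=> PQ; apply: ae_mono2 => x Px Qx Dx.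
by apply: PQ; [move: Dx; rewrite /= in_itv|exact: Px|exact: Qx].
Qed.

Lemma ae_on_all L (P : R -> Prop) : (forall x, 0 <= x <= L -> P x) -> ae_on L P.
Proof. by move=> PQ; apply: aeW => x /=; rewrite in_itv; exact: PQ. Qed.

Lemma eq_ae_Rint L f g : measurable_fun `[0, L] f -> measurable_fun `[0, L] g ->
  ae_on L (fun x => f x = g x) ->
  \int[mu]_(x in `[0, L]) f x = \int[mu]_(x in `[0, L]) g x.
Proof.
move=> mf mg fg; congr fine; apply: ae_eq_integral => //.
- exact/measurable_EFinP.
- exact/measurable_EFinP.
- by apply: (ae_mono _ fg) => x /= fgx Dx; rewrite fgx.
Qed.

Lemma eq_Rint L f g : (forall x, 0 <= x <= L -> f x = g x) ->
  \int[mu]_(x in `[0, L]) f x = \int[mu]_(x in `[0, L]) g x.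
Proof. by move=> fg; apply: eq_Rintegral => x; rewrite inE /= in_itv; exact: fg. Qed.

Lemma le_ae_Rint L f g : L1per L f -> L1per L g ->
  ae_on L (fun x => f x <= g x) ->
  \int[mu]_(x in `[0, L]) f x <= \int[mu]_(x in `[0, L]) g x.
Proof.
move=> lf lg fg.
have mf := L1per_meas lf; have mg := L1per_meas lg.
rewrite (@eq_ae_Rint _ g (fun x => Num.max (f x) (g x))) //; last 2 first.
- exact: measurable_maxr.
- by apply: ae_on_mono fg => x _ fg; rewrite max_r.
apply: le_Rintegral => //.
- apply: (@L1per_le _ _ (fun x => `|f x| + `|g x|)).
  + exact: measurable_maxr.
  + by apply: L1perD; apply: integrable_norm.
  + apply: ae_on_all => x _; rewrite maxEle; case: ifP => _; rewrite ?lerDl ?lerDr //.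
- by move=> x _; rewrite le_max lexx.
Qed.

Lemma ipC L f g : ip L f g = ip L g f.
Proof. by rewrite /ip; under eq_Rintegral do rewrite mulrC. Qed.

Lemma ipDl L f g h : L2per L f -> L2per L g -> L2per L h ->
  ip L (fun x => f x + g x) h = ip L f h + ip L g h.
Proof.
move=> lf lg lh; rewrite /ip -RintegralD //; try exact: L2per_L1perM.
by under eq_Rintegral do rewrite mulrDl.
Qed.

Lemma ipZl L c f g : L2per L f -> L2per L g ->
  ip L (fun x => c * f x) g = c * ip L f g.
Proof.
move=> lf lg; rewrite /ip -RintegralZl //; try exact: L2per_L1perM.
by under eq_Rintegral do rewrite -mulrA.
Qed.

Lemma ipDr L f g h : L2per L f -> L2per L g -> L2per L h ->
  ip L h (fun x => f x + g x) = ip L h f + ip L h g.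
Proof. by move=> lf lg lh; rewrite ipC ipDl // !(ipC _ h). Qed.

Lemma ipZr L c f g : L2per L f -> L2per L g ->
  ip L g (fun x => c * f x) = c * ip L g f.
Proof. by move=> lf lg; rewrite ipC ipZl // ipC. Qed.

Lemma ip_ge0 L f : 0 <= ip L f f.
Proof. by apply: Rintegral_ge0 => x _; rewrite -expr2 sqr_ge0. Qed.

Lemma ip_comb L f g s t : L2per L f -> L2per L g ->
  ip L (fun x => s * f x + t * g x) (fun x => s * f x + t * g x) =
  s ^+ 2 * ip L f f + 2 * s * t * ip L f g + t ^+ 2 * ip L g g.
Proof.
move=> lf lg.
have lsf := L2perZ s lf; have ltg := L2perZ t lg.
rewrite ipDl // ?ipDr //; last exact: L2perD.
rewrite !(ipZl, ipZr) // (ipC L g f); ring.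
Qed.

Lemma cauchy_schwarz L f g : L2per L f -> L2per L g ->
  ip L f g ^+ 2 <= ip L f f * ip L g g.
Proof.
move=> lf lg.
have P s t : 0 <= s ^+ 2 * ip L f f + 2 * s * t * ip L f g + t ^+ 2 * ip L g g.
  by rewrite -ip_comb //; exact: ip_ge0.
have := ip_ge0 L f; have := ip_ge0 L g.
move: (ip L f f) (ip L f g) (ip L g g) P => a b c P c0 a0.
have [c00|cn0] := eqVneq c 0.
  rewrite c00 mulr0; have [->|bn0] := eqVneq b 0; first by rewrite expr0n.
  (* for [c = 0] the form is affine in [t]; this [t] makes it equal to [-1] *)
  have := P 1 (- (a + 1) / (2 * b)); rewrite c00 mulr0 addr0.
  have -> : 1 ^+ 2 * a + 2 * 1 * (- (a + 1) / (2 * b)) * b = -1.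
    by field.
  by rewrite ler0N1.
have cp : 0 < c by rewrite lt_neqAle eq_sym cn0.
have := P c (- b).
have -> : c ^+ 2 * a + 2 * c * - b * b + (- b) ^+ 2 * c = c * (a * c - b ^+ 2) by ring.
by rewrite pmulr_rge0 // subr_ge0.
Qed.

Lemma eq_ae_ip L f f' g g' : L2per L f -> L2per L f' -> L2per L g -> L2per L g' ->
  ae_on L (fun x => f x = f' x) -> ae_on L (fun x => g x = g' x) ->
  ip L f g = ip L f' g'.
Proof.
move=> lf lf' lg lg' ff' gg'; apply: eq_ae_Rint.
- by apply: measurable_funM; apply: L2per_meas.
- by apply: measurable_funM; apply: L2per_meas.
- by apply: ae_on_mono2 ff' gg' => x _ -> ->.
Qed.

Lemma Rint_cst L c : 0 < L -> \int[mu]_(x in `[0, L]) c = c * L.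
Proof.
by move=> L0; rewrite Rintegral_cst //= lebesgue_measure_itv /= lte_fin L0 sube0.
Qed.

Lemma dct_Rint L (fn : nat -> R -> R) f h :
  (forall n, measurable_fun `[0, L] (fn n)) -> measurable_fun `[0, L] f ->
  L1per L h -> (forall n, ae_on L (fun x => `|fn n x| <= h x)) ->
  ae_on L (fun x => fn n x @[n --> \oo] --> f x) ->
  (\int[mu]_(x in `[0, L]) fn n x) @[n --> \oo] --> \int[mu]_(x in `[0, L]) f x.
Proof.
move=> mfn mf lh fnh fnf.
have [] := @dominated_convergence _ _ _ mu `[0, L] (measurable_period L)
  (fun n x => (fn n x)%:E) (EFin \o f) (EFin \o h).
- by move=> n; apply/measurable_EFinP; exact: mfn.
- exact/measurable_EFinP.
- apply: (ae_mono _ fnf) => x fnfx Dx; apply: cvg_EFin; [exact: nearW|exact: fnfx].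
- by [].
- have : {ae mu, forall x, forall n, `[0, L] x -> `|fn n x| <= h x}.
    by apply/ae_foralln => n; exact: fnh.
  by apply: ae_mono => x /= fnh' n Dx; rewrite lee_fin; exact: fnh'.
move=> if_ _ H; rewrite /Rintegral; apply: fine_cvg.
rewrite fineK; last exact: integrable_fin_num.
exact: H.
Qed.

End Toolkit.
#[global] Hint Resolve measurable_period : core.

(** * Primitives and the fundamental theorem of calculus *)

Section Primitives.
Context {R : realType}.
Local Open Scope classical_set_scope.
Notation mu := (@lebesgue_measure R).
Implicit Types (L a b x y : R) (f g h H : R -> R).

(** For [x < 0] the interval is empty and the value is [0]; only [0 <= x] is of
    interest. *)
Definition prim f x := \int[mu]_(t in `[0, x]) f t.

Lemma is_derive_continuous H h : (forall x, is_derive x 1 H (h x)) -> continuous H.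
Proof.
move=> dH x; apply/differentiable_continuous/derivable1_diffP.
by have [] := dH x.
Qed.

Lemma cont_add f g : continuous f -> continuous g -> continuous (fun x => f x + g x).
Proof. by move=> cf cg x; exact: (continuousD (cf x) (cg x)). Qed.

Lemma cont_mul f g : continuous f -> continuous g -> continuous (fun x => f x * g x).
Proof. by move=> cf cg x; exact: (continuousM (cf x) (cg x)). Qed.

Lemma is_derive_derive1 H h : (forall x, is_derive x 1 H (h x)) -> derive1 H = h.
Proof. by move=> dH; apply/funext => x; rewrite derive1E; have [] := dH x. Qed.

Lemma continuous_integrable_itv h a b : continuous h ->
  mu.-integrable `[a, b] (EFin \o h).
Proof.
move=> ch; apply: continuous_compact_integrable; first exact: segment_compact.
exact: continuous_subspaceT.
Qed.

Lemma continuous_L1per L h : continuous h -> L1per L h.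
Proof. exact: continuous_integrable_itv. Qed.

Lemma continuous_measI L h : continuous h -> measurable_fun `[0, L] h.
Proof. by move=> /continuous_L1per/L1per_meas. Qed.

Lemma continuous_L2per L h : continuous h -> L2per L h.
Proof.
move=> ch; split; first exact: continuous_measI.
rewrite (_ : (fun x => h x ^+ 2) = (fun x => h x * h x)).
  by apply/continuous_L1per/cont_mul.
by apply/funext => x; rewrite expr2.
Qed.

Lemma is_derive_FTC1 f a x : mu.-integrable `[a, x + 1] (EFin \o f) ->
  a < x -> {for x, continuous f} ->
  is_derive x 1 (fun y => \int[mu]_(t in `[a, y]) f t) (f x).
Proof.
move=> intf ax cf.
have xx1 : x < x + 1 by rewrite ltrDl.
have [d e] := continuous_FTC1_closed xx1 intf ax cf.
by apply: (DeriveDef d); rewrite -derive1E; exact: e.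
Qed.

(** A primitive on the whole line: the integrals from [- n] normalized at [0]
    agree for different [n] wherever they make sense, so they glue. *)
Lemma primitive_exists h : continuous h ->
  exists H, H 0 = 0 /\ forall x, is_derive x 1 H (h x).
Proof.
move=> ch.
pose P (n : nat) x := \int[mu]_(t in `[- n%:R, x]) h t - \int[mu]_(t in `[- n%:R, 0]) h t.
have ih a b : mu.-integrable `[a, b] (EFin \o h) by exact: continuous_integrable_itv.
have split_ (m n : nat) x : (m <= n)%N -> - m%:R < x ->
    \int[mu]_(t in `[- n%:R, x]) h t =
    \int[mu]_(t in `[- n%:R, - m%:R]) h t + \int[mu]_(t in `[- m%:R, x]) h t.
  move=> mn mx; apply/eqP; rewrite addrC -subr_eq; apply/eqP.
  rewrite Rintegral_itvB //; last 2 first.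
  - by rewrite bnd_simp lerN2 ler_nat.
  - by rewrite bnd_simp ltW.
  by apply: Rintegral_itv_obnd_cbnd; apply: integrableS (ih (- m%:R) x) => //; exact: subset_itv_oc_cc.
have P_eq (m n : nat) x : (0 < m)%N -> (m <= n)%N -> - m%:R < x -> P m x = P n x.
  move=> m0 mn mx; rewrite /P (split_ m n x) // (split_ m n 0) ?oppr_lt0 ?ltr0n //; ring.
pose N x := (Num.truncn `|x|).+1.
have NP x : - (N x)%:R < x.
  by rewrite ltrNl; apply: le_lt_trans (truncnS_gt `|x|); rewrite -normrN ler_norm.
have PN (m : nat) x : (0 < m)%N -> - m%:R < x -> P (N x) x = P m x.
  move=> m0 mx; have [le|/ltnW le] := leqP (N x) m; first exact: P_eq.
  by apply/esym/P_eq.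
exists (fun x => P (N x) x); split; first by rewrite /P subrr.
move=> x.
pose M := (N x).+1.
have Mx : - M%:R < x by apply: lt_trans (NP x); rewrite ltrN2 ltr_nat.
apply: (@near_eq_is_derive _ _ _ (P M)).
  by near=> y; apply/esym/PN => //; near: y; exact: lt_nbhsr.
rewrite -[h x]subr0 /P; apply: is_deriveB.
by apply: is_derive_FTC1 => //; exact: ch.
Unshelve. all: by end_near. Qed.

Lemma FTC2_Rint h H a b : continuous h -> (forall x, is_derive x 1 H (h x)) ->
  a <= b -> \int[mu]_(t in `[a, b]) h t = H b - H a.
Proof.
move=> ch dH; rewrite le_eqVlt => /predU1P[<-|ab].
  by rewrite set_itv1 Rintegral_set1 subrr.
have cH := is_derive_continuous dH.
rewrite /Rintegral (@continuous_FTC2 R h H a b) //.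
- exact: continuous_subspaceT.
- split.
  + by move=> x _; have [] := dH x.
  + exact/cvg_at_right_filter/cH.
  + exact/cvg_at_left_filter/cH.
- by move=> x _; rewrite (is_derive_derive1 dH).
Qed.

(** The increment [H (x + L) - H x] has zero derivative. *)
Lemma periodic_primitive L h H : periodic h L -> (forall x, is_derive x 1 H (h x)) ->
  H L = H 0 -> periodic H L.
Proof.
move=> hL dH HL x; apply/eqP; rewrite -subr_eq0; apply/eqP.
pose K y := H (y + L) - H y.
have dK y : is_derive y 1 K 0.
  rewrite -(subrr (h y)) -{1}(hL y); apply: is_deriveB.
  rewrite -[h (y + L)]mulr1.
  apply: (@is_derive1_comp _ H (fun z => z + L)).
  exact: is_derive_shift.
by have := is_derive_0_is_cst x 0 dK; rewrite /K add0r HL subrr.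
Qed.

Lemma testC1per_primitive L h H : continuous h -> (forall x, is_derive x 1 H (h x)) ->
  periodic H L -> testC1per L H.
Proof.
move=> ch dH HL; split; [exact: HL|by move=> x; have [] := dH x|].
by rewrite (is_derive_derive1 dH).
Qed.

Lemma testC1per_is_derive L H : testC1per L H -> forall x, is_derive x 1 H (derive1 H x).
Proof. by case=> _ dH _ x; apply: DeriveDef; rewrite ?derive1E. Qed.

Lemma testC1per_continuous L H : testC1per L H -> continuous H.
Proof. by move=> /testC1per_is_derive; exact: is_derive_continuous. Qed.

Lemma periodicL0 L H : periodic H L -> H L = H 0.
Proof. by move=> HL; rewrite -[in LHS](add0r L) HL. Qed.

(** Integration by parts; the boundary terms cancel by periodicity. *)
Lemma is_wderiv_C1 L H : 0 < L -> testC1per L H -> is_wderiv L H (derive1 H).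
Proof.
move=> L0 tH; have [pH _ cdH] := tH; split; first exact: continuous_L2per.
move=> phi tphi; have [pp _ cdp] := tphi.
have dH := testC1per_is_derive tH; have dp := testC1per_is_derive tphi.
have cH := testC1per_continuous tH; have cp := testC1per_continuous tphi.
apply/eqP; rewrite -addr_eq0; apply/eqP.
rewrite -RintegralD //; last 2 first.
- by apply/continuous_L1per/cont_mul.
- by apply/continuous_L1per/cont_mul.
pose k x := H x * derive1 phi x + derive1 H x * phi x.
have ck : continuous k.
  by apply: cont_add; apply: cont_mul.
have dk x : is_derive x 1 (fun y => H y * phi y) (k x).
  by apply: is_derive_eq; rewrite /GRing.scale /= (mulrC (phi x)).
by rewrite (FTC2_Rint ck dk (ltW L0)) (periodicL0 pH) (periodicL0 pp) subrr.
Qed.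

Lemma test_cst L c : testC1per L (fun=> c).
Proof.
split; [by []|by move=> x; exact: derivable_cst|].
have -> : derive1 (fun=> c) = (fun=> 0) :> (R -> R).
  by apply: is_derive_derive1 => x; exact: is_derive_cst.
exact: cst_continuous.
Qed.

(** The Lebesgue differentiation theorem, for [f] extended by [0]. *)
Lemma ae_is_derive_prim L f : 0 < L -> L1per L f ->
  ae_on L (fun x => 0 < x < L -> is_derive x 1 (prim f) (f x)).
Proof.
move=> L0 lf.
pose F := f \_ `[0, L].
have iF : mu.-integrable [set: R] (EFin \o F).
  by rewrite -restrict_EFin; apply/(integrable_mkcond _ _).1.
have := @FTC1 R F (BLeft 0).
have locF : locally_integrable [set: R] F by exact: integrable_locally.
move=> /(_ _ locF) H.
have {}H := H _.
have iF0 y : mu.-integrable `[0, y] (EFin \o F) by apply: integrableS iF.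
move: {H}(H iF0) => H.
apply: (ae_mono _ H) => x /= Hx Dx /andP[x0 xL].
have [] := Hx; first by rewrite lte_fin.
have -> : F x = f x by rewrite /F patchE mem_set.
move=> d e; apply: (@near_eq_is_derive _ _ _ (fun y => \int[mu]_(t in `[0, y]) F t)).
- near=> y; have yL : y <= L by near: y; exact: lt_le_nbhsl.
  rewrite /prim; apply: eq_Rintegral => t; rewrite inE /= in_itv /= => /andP[t0 ty].
  by rewrite /F patchE mem_set //= in_itv /= t0 (le_trans ty).
- by apply: (DeriveDef d); rewrite -derive1E; exact: e.
Unshelve. all: by end_near. Qed.

Lemma prim_within_continuous L f : 0 <= L -> L1per L f ->
  {within `[0, L], continuous (prim f)}.
Proof. by move=> L0 lf; apply: parameterized_integral_continuous. Qed.

Lemma L1perS L f x : x <= L -> L1per L f -> L1per x f.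
Proof.
move=> xL; apply: integrableS => //.
by apply: subset_itvl; rewrite bnd_simp.
Qed.

Lemma primE L f x : x <= L ->
  prim f x = \int[mu]_(t in `[0, L]) (f t * \1_(`[0, x]) t).
Proof.
move=> xL; rewrite /prim.
have {1}-> : (`[0, x] : set R) = `[0, L] `&` `[0, x].
  apply/seteqP; split => t /=; rewrite !in_itv /=; last by case.
  by case/andP => -> tx; rewrite tx (le_trans tx).
rewrite Rintegral_mkcondr; apply: eq_Rint => t tL.
by rewrite patchE indicE; case: ifP => _; rewrite ?mulr1 ?mulr0.
Qed.

Lemma prim0 f : prim f 0 = 0.
Proof. by rewrite /prim set_itv1 Rintegral_set1. Qed.

Lemma primB L f g x : x <= L -> L1per L f -> L1per L g ->
  prim (fun t => f t - g t) x = prim f x - prim g x.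
Proof. by move=> xL lf lg; rewrite /prim RintegralB //; exact: L1perS xL _. Qed.

Lemma prim_cst c x : 0 <= x -> prim (fun=> c) x = c * x.
Proof.
rewrite le_eqVlt => /predU1P[<-|x0]; first by rewrite prim0 mulr0.
by rewrite /prim Rint_cst.
Qed.

End Primitives.

(** * The lemma of du Bois-Reymond *)

Section DuBoisReymond.
Context {R : realType}.
Local Open Scope classical_set_scope.
Notation mu := (@lebesgue_measure R).
Implicit Types (L b x y : R) (f g h : R -> R).

Lemma ae_neq (a : R) : {ae mu, forall x, x != a}.
Proof.
exists [set a]; split => //; first exact: lebesgue_measure_set1.
by move=> x /= /negP; rewrite negbK => /eqP.
Qed.

(** The end points form a null set. *)
Lemma ae_on_open L (P : R -> Prop) : ae_on L (fun x => 0 < x < L -> P x) -> ae_on L P.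
Proof.
move=> H; have := ae_mono2 (fun x u v => conj u v) (ae_neq 0) (ae_neq L).
apply: ae_mono2 H => x /= Px [x0 xL] Dx; apply: Px => //.
by move: Dx; rewrite in_itv /= !lt_neqAle (eq_sym 0) x0 xL; case/andP => -> ->.
Qed.

(** The identity that defines weak derivatives, here for pairs that are merely
    integrable. *)
Definition weak_rel L f g := forall phi, testC1per L phi ->
  \int[mu]_(x in `[0, L]) (f x * derive1 phi x) =
  - \int[mu]_(x in `[0, L]) (g x * phi x).

(** A product of two sines, so that it is [L]-periodic and its sign on a period
    is explicit. *)
Definition bump L b x := sin (pi * x / L) * sin (pi * (b - x) / L).

(** A clamped multiple of [bump]: continuous, periodic, and tending to the
    indicator of [`]0, b[] on a period. *)
Definition plateau L b (n : nat) x : R := Num.min 1 (Num.max 0 (n%:R * bump L b x)).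

Lemma plateau_ge0 L b n x : 0 <= plateau L b n x.
Proof. by rewrite /plateau le_min ler01 le_max lexx. Qed.

Lemma plateau_le1 L b n x : plateau L b n x <= 1.
Proof. by rewrite /plateau ge_min lexx. Qed.

Lemma cont_affine (c d : R) : continuous (fun x => c * x + d).
Proof.
apply: cont_add; last exact: cst_continuous.
by apply: cont_mul; [exact: cst_continuous|move=> x; exact: cvg_id].
Qed.

Lemma cont_max f g : continuous f -> continuous g ->
  continuous (fun x => Num.max (f x) (g x)).
Proof.
move=> cf cg.
have -> : (fun x => Num.max (f x) (g x)) = (fun x => (f x + g x + `|f x - g x|) / 2).
  by apply/funext => x; rewrite maxr_absE.
move=> x; apply: cvgM; last exact: cvg_cst.
apply: cvgD; first exact: (cont_add cf cg).
by apply: cvg_norm; apply: cvgB; [exact: cf|exact: cg].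
Qed.

Lemma cont_min f g : continuous f -> continuous g ->
  continuous (fun x => Num.min (f x) (g x)).
Proof.
move=> cf cg.
have -> : (fun x => Num.min (f x) (g x)) = (fun x => (f x + g x - `|f x - g x|) / 2).
  by apply/funext => x; rewrite minr_absE.
move=> x; apply: cvgM; last exact: cvg_cst.
apply: cvgB; first exact: (cont_add cf cg).
by apply: cvg_norm; apply: cvgB; [exact: cf|exact: cg].
Qed.

Lemma bump_continuous L b : continuous (bump L b).
Proof.
apply: cont_mul => x; (apply: continuous_comp; last exact: continuous_sin).
- have -> : (fun x => pi * x / L) = (fun x => pi / L * x + 0).
    by apply/funext => y; rewrite addr0 mulrAC.
  exact: cont_affine.
- have -> : (fun x => pi * (b - x) / L) = (fun x => (- (pi / L)) * x + pi * b / L).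
    by apply/funext => y; rewrite mulrBr mulrBl addrC mulNr mulrAC.
  exact: cont_affine.
Qed.

Lemma plateau_continuous L b n : continuous (plateau L b n).
Proof.
apply: cont_min; first exact: cst_continuous.
apply: cont_max; first exact: cst_continuous.
by apply: cont_mul; [exact: cst_continuous|exact: bump_continuous].
Qed.

Lemma bump_periodic L b : 0 < L -> periodic (bump L b) L.
Proof.
move=> L0 x; rewrite /bump.
have Ln0 : L != 0 by rewrite gt_eqF.
have -> : pi * (x + L) / L = pi * x / L + pi by field.
have E : pi * (b - x) / L = pi * (b - (x + L)) / L + pi by field.
by rewrite E !sinDpi mulNr mulrN.
Qed.

Lemma plateau_periodic L b n : 0 < L -> periodic (plateau L b n) L.
Proof. by move=> L0 x; rewrite /plateau bump_periodic. Qed.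

(** On a period the first factor is nonnegative, and the second has the sign of
    [b - x]. *)
Lemma bump_gt0 L b x : 0 < b < L -> 0 <= x <= L -> (0 < bump L b x) = (0 < x < b).
Proof.
move=> /andP[b0 bL] /andP[x0 xL].
have L0 : 0 < L by exact: lt_trans bL.
have Ln0 : L != 0 by rewrite gt_eqF.
have p0 := @pi_gt0 R.
have [->|xn0] := eqVneq x 0; first by rewrite /bump mulr0 mul0r sin0 mul0r ltxx.
have [->|xnL] := eqVneq x L.
  by rewrite /bump mulfK // sinpi mul0r ltxx (ltNge L b) (ltW bL) andbF.
have {}x0 : 0 < x by rewrite lt_neqAle eq_sym xn0.
have {}xL : x < L by rewrite lt_neqAle xnL.
have S (y : R) : 0 < y < L -> 0 < sin (pi * y / L).
  move=> /andP[y0 yL]; apply: sin_gt0_pi.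
  apply/andP; split; first by rewrite divr_gt0 // mulr_gt0.
  by rewrite ltr_pdivrMr // ltr_pM2l.
rewrite /bump pmulr_rgt0; last by apply: S; rewrite x0.
rewrite x0 /=; have [xb|bx|->] := ltgtP x b.
- by apply: S; rewrite subr_gt0 xb /= ltrBlDr ltr_wpDr // ltW.
- apply/negbTE; rewrite -leNgt -[b - x]opprB mulrN mulNr sinN oppr_le0 ltW //.
  by apply: S; rewrite subr_gt0 bx /= ltrBlDr (lt_le_trans xL) // lerDl ltW.
- by rewrite subrr mulr0 mul0r sin0 ltxx.
Qed.

Lemma plateau_cvg L b x : 0 < b < L -> 0 <= x <= L ->
  plateau L b n x @[n --> \oo] --> (\1_(`]0, b[) x : R).
Proof.
move=> bL xL; rewrite indicE mem_setE in_itv /= -(bump_gt0 bL xL).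
have [s0|s0] := ltP 0 (bump L b x).
- apply: cvg_near_cst; near=> n.
  rewrite /plateau max_r; last by rewrite mulr_ge0 // ltW.
  rewrite min_l // -ler_pdivrMr //; near: n; exact: nbhs_infty_ger.
- apply: cvg_near_cst; near=> n.
  by rewrite /plateau max_l ?min_r // mulr_ge0_le0.
Unshelve. all: by end_near. Qed.

Lemma prim_indic b x : 0 < b -> 0 <= x -> prim \1_(`]0, b[) x = Num.min x b.
Proof.
move=> b0; rewrite le_eqVlt => /predU1P[<-|x0]; first by rewrite prim0 min_l ?ltW.
rewrite /prim -[LHS]/(\int[mu]_(t in `[0, x]) (\1_(`]0, b[) t : R)).
have -> : \int[mu]_(t in `[0, x]) (\1_(`]0, b[) t : R) =
          \int[mu]_(t in `[0, x] `&` `]0, b[) 1.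
  rewrite Rintegral_mkcondr; apply: eq_Rintegral => t _.
  by rewrite patchE indicE; case: ifP.
have [xb|bx] := ltP x b.
- have -> : `[0, x] `&` `]0, b[ = (`]0, x] : set R).
    apply/seteqP; split => t /=; rewrite !in_itv /=.
      by case=> /andP[_ ->] /andP[->].
    by case/andP=> t0 tx; rewrite t0 tx (ltW t0) (le_lt_trans tx).
  by rewrite Rintegral_cst //= lebesgue_measure_itv /= lte_fin x0 sube0 mul1r.
- have -> : `[0, x] `&` `]0, b[ = (`]0, b[ : set R).
    apply/seteqP; split => t /=; rewrite !in_itv /=; first by case.
    by case/andP=> t0 tx; rewrite t0 tx (ltW t0) (le_trans (ltW tx)).
  by rewrite Rintegral_cst //= lebesgue_measure_itv /= lte_fin b0 sube0 mul1r.
Qed.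

Lemma Rint_indic L f b : 0 < b < L -> L1per L f ->
  \int[mu]_(x in `[0, L]) (f x * \1_(`]0, b[) x) = prim f b.
Proof.
move=> /andP[b0 bL] lf.
have lb : L1per b f by apply: (L1perS (ltW bL)).
have -> : \int[mu]_(x in `[0, L]) (f x * \1_(`]0, b[) x) =
          \int[mu]_(x in `[0, L] `&` `]0, b[) f x.
  rewrite Rintegral_mkcondr; apply: eq_Rintegral => t _.
  by rewrite patchE indicE; case: ifP; rewrite ?mulr1 ?mulr0.
have -> : `[0, L] `&` `]0, b[ = (`]0, b[ : set R).
  apply/seteqP; split => t /=; rewrite !in_itv /=; first by case.
  by case/andP=> t0 tx; rewrite t0 tx (ltW t0) (le_trans (ltW tx)) // ltW.
rewrite Rintegral_itv_bndo_bndc; last first.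
  by apply: integrableS lb => //; exact: subset_itv_oo_cc.
rewrite Rintegral_itv_obnd_cbnd //.
by apply: integrableS lb => //; exact: subset_itv_oc_cc.
Qed.

(** Test against a constant. *)
Lemma weak_rel_int0 L f g : weak_rel L f g -> \int[mu]_(x in `[0, L]) g x = 0.
Proof.
move=> /(_ _ (test_cst L 1)).
have -> : derive1 (fun=> 1 : R) = (fun=> 0) :> (R -> R).
  by apply: is_derive_derive1 => x; exact: is_derive_cst.
under eq_Rintegral do rewrite mulr0.
under [in RHS]eq_Rintegral do rewrite mulr1.
by rewrite Rintegral_cst // mul0r => /eqP; rewrite eq_sym oppr_eq0 => /eqP.
Qed.

(** Subtracting the mean makes the primitive periodic, hence a test function. *)
Lemma test_plateau L b n : 0 < L ->
  let m := (\int[mu]_(x in `[0, L]) plateau L b n x) / L in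
  exists phi, [/\ testC1per L phi, derive1 phi = (fun x => plateau L b n x - m) &
    forall x, 0 <= x <= L -> phi x = prim (plateau L b n) x - m * x].
Proof.
move=> L0 m; have cp := @plateau_continuous L b n.
have ct : continuous (fun x => plateau L b n x - m).
  by apply: cont_add => //; exact: cst_continuous.
have [phi [phi0 dphi]] := primitive_exists ct.
have phiE x : 0 <= x <= L -> phi x = prim (plateau L b n) x - m * x.
  move=> /andP[x0 xL]; have := FTC2_Rint ct dphi x0; rewrite phi0 subr0 => <-.
  by rewrite -[LHS]/(prim _ x) (primB xL) ?prim_cst //; [exact: continuous_L1per|exact: L1per_cst].
exists phi; split => //; last exact: is_derive_derive1.
apply: (testC1per_primitive ct) => //; apply: periodic_primitive dphi _.
  by move=> x; rewrite plateau_periodic.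
rewrite phi0 phiE ?lexx ?ltW //.
by rewrite /m mulfVK ?gt_eqF // /prim subrr.
Qed.

(** Pairing the weak relation with a [C^1] approximation of the tent function
    [x |-> Num.min x b - b / L * x], whose derivative is [1 - b / L] before [b]
    and [- b / L] after [b]. *)
Lemma weak_rel_prim L f g b : 0 < b < L -> L1per L f -> L1per L g -> weak_rel L f g ->
  prim f b = (\int[mu]_(x in `[0, L]) f x + \int[mu]_(x in `[0, L]) (x * g x)) / L * b
             - prim (fun x => x * g x) b + b * prim g b.
Proof.
move=> bL lf lg fg; have [b0 bL'] := andP bL.
have L0 : 0 < L by exact: lt_trans bL'.
have Ln0 : L != 0 by rewrite gt_eqF.
pose psi := plateau L b.
pose m n := (\int[mu]_(x in `[0, L]) psi n x) / L.
have mpsi n x : measurable_fun `[0, x] (psi n) by apply: continuous_measI; exact: plateau_continuous.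
have mchi x : measurable_fun `[0, x] (\1_(`]0, b[) : R -> R) by exact: measurable_indic.
have psi1 n x : `|psi n x| <= 1 by rewrite ger0_norm ?plateau_ge0 ?plateau_le1.
have lchi : L1per L \1_(`]0, b[).
  apply: (@L1per_bounded _ _ _ 1) => //; apply: ae_on_all => x _.
  by rewrite indicE; case: (_ \in _); rewrite ?normr1 ?normr0.
(* [psi n] tends to the indicator of [`]0, b[], hence its primitive to
   [Num.min x b] and its mean [m n] to [b / L] *)
have psi_cvg x : 0 <= x <= L -> prim (psi n) x @[n --> \oo] --> Num.min x b.
  move=> /andP[x0 xL]; rewrite -(prim_indic b0 x0).
  apply: (dct_Rint (h := fun=> 1)) => //; first exact: L1per_cst.
    by move=> n; apply: ae_on_all.
  apply: ae_on_all => y /andP[y0 yx]; apply: plateau_cvg => //.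
  by rewrite y0 (le_trans yx).
have m_cvg : m n @[n --> \oo] --> b / L.
  apply: cvgMr_tmp; rewrite -[X in _ --> X](min_r (ltW bL')).
  by apply: psi_cvg; rewrite lexx ltW.
have m1 n : `|m n| <= 1.
  rewrite normrM normfV (gtr0_norm L0) ler_pdivrMr // mul1r.
  apply: le_trans (le_normr_Rintegral _ _) _ => //; first by apply: continuous_L1per; exact: plateau_continuous.
  rewrite -[leRHS]mul1r -Rint_cst //; apply: le_Rintegral => //.
  - by apply: integrable_norm; by apply: continuous_L1per; exact: plateau_continuous.
  - exact: L1per_cst.
pose tent x := Num.min x b - b / L * x.
have mid : measurable_fun `[0, L] (fun x : R => x) by exact: measurable_id.
have lid (k : R -> R) : L1per L k -> L1per L (fun x => x * k x).
  move=> lk; apply: (@L1per_le _ _ _ (fun x => L * `|k x|)).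
  - by apply: measurable_funM => //; exact: L1per_meas.
  - by apply: L1perZ; exact: integrable_norm.
  - apply: ae_on_all => x /andP[x0 xL].
    by rewrite normrM (ger0_norm x0) ler_wpM2r.
have cmin : continuous (fun x => Num.min x b).
  by apply: cont_min; [move=> x; exact: cvg_id|exact: cst_continuous].
have mtent : measurable_fun `[0, L] tent.
  apply: measurable_funB; first exact: continuous_measI.
  exact: measurable_funM.
have lhs_cvg : \int[mu]_(x in `[0, L]) (f x * (psi n x - m n)) @[n --> \oo] -->
    prim f b - b / L * \int[mu]_(x in `[0, L]) f x.
  have -> : prim f b - b / L * \int[mu]_(x in `[0, L]) f x =
      \int[mu]_(x in `[0, L]) (f x * (\1_(`]0, b[) x - b / L)).
    rewrite -(Rint_indic bL lf) -RintegralZl // -RintegralB //; last first.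
    - exact: L1perZ.
    - apply: L1per_le (integrable_norm lf) _.
        by apply: measurable_funM; [exact: L1per_meas|].
      apply: ae_on_all => x _; rewrite normrM ler_piMr //.
      by rewrite indicE; case: (_ \in _); rewrite ?normr1 ?normr0.
    by apply: eq_Rint => x _; ring.
  apply: (dct_Rint (h := fun x => 2 * `|f x|)).
  - move=> n; apply: measurable_funM; first exact: L1per_meas.
    by apply: measurable_funB.
  - apply: measurable_funM; first exact: L1per_meas.
    by apply: measurable_funB.
  - by apply: L1perZ; exact: integrable_norm.
  - move=> n; apply: ae_on_all => x _; rewrite normrM mulrC ler_wpM2r //.
    by rewrite (le_trans (ler_normB _ _)) // -[2]/(1 + 1) lerD.
  - apply: ae_on_all => x xL; apply: cvgMl_tmp; apply: cvgB => //; exact: plateau_cvg.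
have rhs_cvg : (- \int[mu]_(x in `[0, L]) (g x * (prim (psi n) x - m n * x))) @[n --> \oo] -->
    - \int[mu]_(x in `[0, L]) (g x * tent x).
  apply: cvgN; apply: (dct_Rint (h := fun x => (2 * L) * `|g x|)).
  - move=> n; apply: measurable_funM; first exact: L1per_meas.
    apply: measurable_funB; last exact: measurable_funM.
    apply: subspace_continuous_measurable_fun => //.
    by apply: prim_within_continuous; [exact: ltW|by apply: continuous_L1per; exact: plateau_continuous].
  - by apply: measurable_funM; [exact: L1per_meas|].
  - by apply: L1perZ; exact: integrable_norm.
  - move=> n; apply: ae_on_all => x /andP[x0 xL]; rewrite normrM mulrC ler_wpM2r //.
    rewrite (le_trans (ler_normB _ _)) // mulr_natl mulr2n lerD //.
      apply: le_trans (le_normr_Rintegral _ _) _ => //; first by apply: continuous_L1per; exact: plateau_continuous.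
      apply: (le_trans _ xL); rewrite -[leRHS]mul1r -prim_cst //; apply: le_Rintegral => //.
      + by apply: integrable_norm; by apply: continuous_L1per; exact: plateau_continuous.
      + exact: L1per_cst.
    by rewrite normrM (ger0_norm x0) -[L]mul1r ler_pM.
  - apply: ae_on_all => x xL; apply: cvgMl_tmp; apply: cvgB; first exact: psi_cvg.
    exact: cvgMr_tmp.
have E n : \int[mu]_(x in `[0, L]) (f x * (psi n x - m n)) =
    - \int[mu]_(x in `[0, L]) (g x * (prim (psi n) x - m n * x)).
  have [phi [tphi dphi phiE]] := @test_plateau L b n L0.
  have := fg _ tphi; rewrite dphi => ->; congr (- _).
  by apply: eq_Rint => x xL; rewrite phiE.
move: lhs_cvg; under eq_fun do rewrite E.
move=> lhs_cvg.
have H : prim f b - b / L * \int[mu]_(x in `[0, L]) f x = - \int[mu]_(x in `[0, L]) (g x * tent x).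
  exact: (cvg_unique (@Rhausdorff R) lhs_cvg rhs_cvg).
have lxg := lid _ lg.
have gtent : \int[mu]_(x in `[0, L]) (g x * tent x) =
    prim (fun x => x * g x) b - b * prim g b - b / L * \int[mu]_(x in `[0, L]) (x * g x).
  have lgb (k : R -> R) : L1per L k -> L1per L (fun x => k x * \1_(`[0, b]) x).
    move=> lk; apply: L1per_le (integrable_norm lk) _.
      by apply: measurable_funM; [exact: L1per_meas|exact: measurable_indic].
    apply: ae_on_all => x _; rewrite normrM ler_piMr //.
    by rewrite indicE; case: (_ \in _); rewrite ?normr1 ?normr0.
  (* the mean of [g] vanishes, so [b * g] may be added on the whole period: past
     [b] the tent is [b - b / L * x] *)
  have -> : prim (fun x => x * g x) b = prim (fun x => x * g x) b + b * \int[mu]_(x in `[0, L]) g x.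
    by rewrite (weak_rel_int0 fg) mulr0 addr0.
  rewrite !(primE _ (ltW bL')) -!RintegralZl //; try exact: lgb.
  rewrite -RintegralD //; [|exact: lgb|exact: L1perZ].
  rewrite -RintegralB //; [|by apply: L1perD; [exact: lgb|exact: L1perZ]|by apply: L1perZ; exact: lgb].
  rewrite -RintegralB //; [|by apply: L1perB; [apply: L1perD; [exact: lgb|exact: L1perZ]|by apply: L1perZ; exact: lgb]|exact: L1perZ].
  apply: eq_Rint => x /andP[x0 xL].
  rewrite /tent indicE mem_setE in_itv /=.
  rewrite x0; have [xb|bx] := leP x b => /=; ring.
move: H; rewrite gtent => /eqP; rewrite subr_eq => /eqP ->.
by field.
Qed.

(** Differentiate the identity of [weak_rel_prim] in [b]: both sides are almost
    everywhere differentiable, and the [b * g b] terms cancel. *)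
Lemma du_bois_reymond L f g : 0 < L -> L1per L f -> L1per L g -> weak_rel L f g ->
  exists C, ae_on L (fun x => f x = C + prim g x).
Proof.
move=> L0 lf lg fg.
set C := (\int[mu]_(x in `[0, L]) f x + \int[mu]_(x in `[0, L]) (x * g x)) / L.
have lxg : L1per L (fun x => x * g x).
  apply: (@L1per_le _ _ _ (fun x => L * `|g x|)).
  - by apply: measurable_funM => //; exact: L1per_meas.
  - by apply: L1perZ; exact: integrable_norm.
  - apply: ae_on_all => x /andP[x0 xL].
    by rewrite normrM (ger0_norm x0) ler_wpM2r.
exists C; apply: ae_on_open.
have H := ae_on_mono2 (fun x _ u v => conj u v) (ae_is_derive_prim L0 lg) (ae_is_derive_prim L0 lxg).
apply: ae_on_mono2 (ae_is_derive_prim L0 lf) H => x _ /= df [dg dxg] x0L.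
have {}df := df x0L; have {}dg := dg x0L; have {}dxg := dxg x0L.
have [x0 xL] := andP x0L.
have d1 : is_derive x 1 (fun y => C * y - prim (fun t => t * g t) y + y * prim g y)
   (C + prim g x).
  apply: is_derive_eq; rewrite /GRing.scale /=; ring.
have d2 : is_derive x 1 (prim f) (C + prim g x).
  apply: near_eq_is_derive d1; near=> y; rewrite (@weak_rel_prim L f g y) //.
  by apply/andP; split; near: y; [exact: lt_nbhsr|exact: lt_nbhsl].
by have [_ <-] := df; have [_ <-] := d2.
Unshelve. all: by end_near. Qed.

Lemma ae_on_dense L (P : R -> Prop) x e : 0 < L -> 0 < e -> 0 <= x <= L -> ae_on L P ->
  exists y, [/\ 0 <= y <= L, `|x - y| < e & P y].
Proof.
move=> L0 e0 /andP[x0 xL] [N [mN N0 PN]].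
pose a := Num.max 0 (x - e); pose c := Num.min L (x + e).
have ac : a < c by rewrite gt_max !lt_min; apply/andP; split; apply/andP; split; lra.
apply: contrapT => H.
have : (mu `]a, c[ <= mu N)%E.
  apply: le_measure; rewrite ?inE //.
  move=> y /=; rewrite in_itv /= gt_max lt_min => /andP[/andP[y0 ye] /andP[yL yx]].
  apply: PN => Py; apply: H; exists y; split; first by rewrite !ltW.
    by rewrite ltr_distlC; lra.
  by apply: Py; rewrite /= in_itv /= !ltW.
by rewrite N0 lebesgue_measure_itv /= lte_fin ac lee_fin leNgt subr_gt0 ac.
Qed.

(** A set of full measure is dense. *)
Lemma within_continuous_eq0 L h : 0 < L -> {within `[0, L], continuous h} ->
  ae_on L (fun x => h x = 0) -> forall x, 0 <= x <= L -> h x = 0.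
Proof.
move=> L0 ch h0 x xL.
have /subspace_continuousP/(_ x) := ch.
rewrite /= in_itv /= => /(_ xL) /cvgrPdist_lt hx.
apply/eqP; rewrite -normr_le0; apply/ler_addgt0Pr => e e0; rewrite add0r.
have := hx _ e0; rewrite near_withinE => /nbhs_ballP[d /= d0 hd].
have [y [yL xy hy]] := ae_on_dense L0 d0 xL h0.
have H1 : `|h x - h y| < e by apply: (hd y xy); rewrite /= in_itv.
by rewrite -[h x]subr0 -hy ltW.
Qed.

Lemma wderiv_L1 L f g : is_wderiv L f g -> L1per L g.
Proof. by case=> /L2per_L1per. Qed.

Lemma wderiv_rep L f g : 0 < L -> L2per L f -> is_wderiv L f g ->
  exists C, ae_on L (fun x => f x = C + prim g x).
Proof.
move=> L0 lf [lg fg]; apply: du_bois_reymond => //; exact: L2per_L1per.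
Qed.

Lemma wderiv_int0 L f g : is_wderiv L f g -> prim g L = 0.
Proof. by case=> _; exact: weak_rel_int0. Qed.

(** The two primitives differ by a constant, and a primitive determines its
    integrand almost everywhere. *)
Lemma wderiv_unique L f g1 g2 : 0 < L -> L2per L f -> is_wderiv L f g1 -> is_wderiv L f g2 ->
  ae_on L (fun x => g1 x = g2 x).
Proof.
move=> L0 lf w1 w2; have l1 := wderiv_L1 w1; have l2 := wderiv_L1 w2.
have [C1 e1] := wderiv_rep L0 lf w1; have [C2 e2] := wderiv_rep L0 lf w2.
pose h x := C1 - C2 + (prim g1 x - prim g2 x).
have h0 : ae_on L (fun x => h x = 0).
  by apply: ae_on_mono2 e1 e2 => x _ -> E; rewrite /h -[RHS](subrr (C2 + prim g2 x)) -{1}E; ring.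
have ch : {within `[0, L], continuous h}.
  apply/subspace_continuousP => x xL; apply: cvgD; first exact: cvg_cst.
  by apply: cvgB; [have := prim_within_continuous (ltW L0) l1|have := prim_within_continuous (ltW L0) l2];
    move/subspace_continuousP; exact.
have {}h0 := within_continuous_eq0 L0 ch h0.
apply: ae_on_open.
apply: ae_on_mono2 (ae_is_derive_prim L0 l1) (ae_is_derive_prim L0 l2) => x _ d1 d2 xL.
have {}d1 := d1 xL; have {}d2 := d2 xL; have [x0 xL'] := andP xL.
have d3 : is_derive x 1 (prim g1) (0 + g2 x).
  apply: (@near_eq_is_derive _ _ _ (fun y => C2 - C1 + prim g2 y)).
    near=> y; have : h y = 0.
      by apply: h0; apply/andP; split; near: y; [exact: lt_le_nbhsr|exact: lt_le_nbhsl].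
    by rewrite /h => E; rewrite -[LHS]addr0 -E; ring.
by have [_ <-] := d1; have [_ ->] := d3; rewrite add0r.
Unshelve. all: by end_near. Qed.

End DuBoisReymond.

(** * Hoelder bounds and completeness of L^2 *)

Section L2Estimates.
Context {R : realType}.
Local Open Scope classical_set_scope.
Notation mu := (@lebesgue_measure R).
Implicit Types (L x y : R) (f g h : R -> R).

Lemma L2per_indic L x : L2per L \1_(`[0, x]).
Proof.
apply: (@L2per_bounded _ _ _ 1); first exact: measurable_indic.
by apply: ae_on_all => y _; rewrite indicE; case: (_ \in _); rewrite ?normr1 ?normr0.
Qed.

Lemma prim_ip L g x : x <= L -> prim g x = ip L g \1_(`[0, x]).
Proof. exact: primE. Qed.

(** Cauchy-Schwarz against the indicator of the interval between [y] and [x],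
    written as a difference of indicators. *)
Lemma prim_hoelder L g x y : 0 <= x <= L -> 0 <= y <= L -> L2per L g ->
  (prim g x - prim g y) ^+ 2 <= `|x - y| * ip L g g.
Proof.
wlog yx : x y / y <= x.
  move=> H xL yL lg; have [yx|/ltW xy] := leP y x; first exact: H.
  by rewrite -sqrrN opprB distrC; exact: H.
move=> /andP[x0 xL] /andP[y0 yL] lg; rewrite (ger0_norm (_ : 0 <= x - y)) ?subr_ge0 //.
have lx := L2per_indic L x; have ly := L2per_indic L y.
pose d t := 1 * \1_(`[0, x]) t + (-1) * \1_(`[0, y]) t : R.
have ld : L2per L d by apply: L2perD; exact: L2perZ.
have -> : prim g x - prim g y = ip L g d.
  rewrite /d ipDr //; [|exact: L2perZ..].
  by rewrite !ipZr // -!prim_ip // mul1r mulN1r.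
have II a b : 0 <= a <= b -> b <= L -> ip L \1_(`[0, a]) \1_(`[0, b]) = a.
  move=> /andP[a0 ab] bL; have aL := le_trans ab bL.
  transitivity (\int[mu]_(t in `[0, L]) (1 * \1_(`[0, a]) t : R)).
    apply: eq_Rint => t /andP[t0 tL]; rewrite mul1r !indicE !mem_setE !in_itv /= t0 /=.
    by have [ta|] := leP t a; rewrite ?mul0r // (le_trans ta) // mulr1.
  by rewrite -(primE (fun=> 1)) // prim_cst // mul1r.
apply: le_trans (cauchy_schwarz lg ld) _.
rewrite mulrC ler_wpM2r ?ip_ge0 //.
rewrite /d ip_comb // (ipC L \1_(`[0, x]) \1_(`[0, y])) !II ?lexx ?x0 ?y0 ?yx //.
by rewrite le_eqVlt; apply/orP; left; apply/eqP; ring.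
Qed.

(** Average [f x ^+ 2 <= 2 * f y ^+ 2 + 2 * (f x - f y) ^+ 2] over [y]. *)
Lemma sup_bound L f g C x : 0 < L -> L2per L f -> L2per L g ->
  ae_on L (fun x => f x = C + prim g x) -> 0 <= x <= L ->
  (C + prim g x) ^+ 2 <= 2 / L * ip L f f + 2 * L * ip L g g.
Proof.
move=> L0 lf lg fE xL.
have H : \int[mu]_(y in `[0, L]) ((C + prim g x) ^+ 2) <=
    \int[mu]_(y in `[0, L]) (2 * (f y * f y) + 2 * L * ip L g g).
  apply: le_ae_Rint; first exact: L1per_cst.
    by apply: L1perD; [apply: L1perZ; exact: L2per_L1perM|exact: L1per_cst].
  apply: ae_on_mono fE => y yL ->.
  have := prim_hoelder xL yL lg.
  have : `|x - y| * ip L g g <= L * ip L g g.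
    by rewrite ler_wpM2r ?ip_ge0 // ler_norml; move: xL yL; lra.
  rewrite -[2 * L * _]mulrA.
  move: (prim g x) (prim g y) (`|x - y| * _) (L * _) => a b c d.
  by have := sqr_ge0 ((C + b) - (a - b)); nra.
move: H; rewrite RintegralD //; last first.
- exact: L1per_cst.
- by apply: L1perZ; exact: L2per_L1perM.
rewrite RintegralZl //; last exact: L2per_L1perM.
rewrite !Rint_cst // -/(ip L f f) => H.
rewrite -(ler_pM2r L0); apply: le_trans H _.
by rewrite le_eqVlt; apply/orP; left; apply/eqP; field; rewrite gt_eqF.
Qed.

Lemma fast_cauchy (u : nat -> R) s : 0 <= s ->
  (forall n, `|u n.+1 - u n| <= s * 2^-1 ^+ n) ->
  exists l, u n @[n --> \oo] --> l /\ forall n, `|l - u n| <= 2 * s * 2^-1 ^+ n.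
Proof.
move=> s0 us.
(* [a] decreases, [b] increases, and they have a common limit *)
pose a n := u n + 2 * s * 2^-1 ^+ n; pose b n := u n - 2 * s * 2^-1 ^+ n.
have h0 n : 0 <= s * 2^-1 ^+ n by rewrite mulr_ge0 // exprn_ge0 // invr_ge0.
have na : nonincreasing_seq a.
  apply/nonincreasing_seqP => n; rewrite /a exprS.
  by have := us n; rewrite ler_norml; have := h0 n; lra.
have nb : nondecreasing_seq b.
  apply/nondecreasing_seqP => n; rewrite /b exprS.
  by have := us n; rewrite ler_norml; have := h0 n; lra.
have ba n : b n <= a n by rewrite /a /b; have := h0 n; lra.
have ca : cvgn a.
  apply: nonincreasing_is_cvgn => //; exists (b 0%N) => _ [n _ <-].
  exact: le_trans (nb _ _ (leq0n n)) (ba n).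
have h2 : (2 * s * 2^-1 ^+ n) @[n --> \oo] --> (0 : R).
  rewrite -(mulr0 (2 * s)); apply: cvgM; first exact: cvg_cst.
  by apply: cvg_expr; rewrite ger0_norm ?invr_ge0 // invf_lt1 // ltr1n.
have cu : u n @[n --> \oo] --> limn a.
  rewrite -[limn a]subr0.
  have -> : u = (fun n => a n - 2 * s * 2^-1 ^+ n).
    by apply/funext => n; rewrite /a addrK.
  exact: cvgB.
exists (limn a); split => // n; rewrite ler_norml.
have la := nonincreasing_cvgn_ge na ca n.
have cb : b @ \oo --> limn a by rewrite -[limn a]subr0; apply: cvgB.
have lb : b n <= limn a.
  by rewrite -(cvg_lim (@Rhausdorff R) cb); apply: nondecreasing_cvgn_le => //; apply/cvg_ex; exists (limn a).
by move: la lb; rewrite /a /b; lra.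
Qed.

(** Completeness of [L^2], along a sequence whose increments are summable with
    a geometric weight: [S] below dominates all the squared remainders. *)
Lemma L2_complete L (gn : nat -> R -> R) : (forall n, L2per L (gn n)) ->
  (forall n, 4 ^+ n * ip L (fun x => gn n.+1 x - gn n x) (fun x => gn n.+1 x - gn n x)
     <= 1 / (2 ^ n.+1)%:R) ->
  exists g, L2per L g /\
    ip L (fun x => g x - gn n x) (fun x => g x - gn n x) @[n --> \oo] --> (0 : R).
Proof.
move=> lgn inc.
pose e n x : R := 4 ^+ n * ((gn n.+1 x - gn n x) * (gn n.+1 x - gn n x)).
have le_ n : L1per L (e n).
  by apply: L1perZ; apply: L2per_L1perM; exact: L2perB.
have e0 n x : 0 <= e n x by rewrite mulr_ge0 ?exprn_ge0 // -expr2 sqr_ge0.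
pose S x := (\sum_(n <oo) (e n x)%:E)%E.
have S0 x : (0 <= S x)%E by apply: nneseries_ge0 => n _ _; rewrite lee_fin.
have mS : measurable_fun `[0, L] S.
  apply: ge0_emeasurable_sum => [n x _ _|n _]; first by rewrite lee_fin.
  by apply/measurable_EFinP; exact: L1per_meas (le_ n).
have iS : (\int[mu]_(x in `[0%R, L]) S x <= 1)%E.
  rewrite integral_nneseries //; last 2 first.
  - by move=> n; by apply/measurable_EFinP; exact: L1per_meas (le_ n).
  - by move=> n x _; rewrite lee_fin.
  apply: le_trans (epsilon_trick0 xpredT (ler01)).
  apply: lee_nneseries => [n _ _|n _].
    by apply: integral_ge0 => x _; rewrite lee_fin.
  rewrite -[leLHS]fineK; last by apply: integrable_fin_num => //; exact: le_.
  rewrite lee_fin; apply: le_trans (inc n).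
  rewrite /ip -RintegralZl //.
  by apply: L2per_L1perM; exact: L2perB.
have intS : mu.-integrable `[0, L] S.
  apply/integrableP; split => //.
  under eq_integral do rewrite gee0_abs //.
  by rewrite (le_lt_trans iS) // ltry.
pose s x := fine (S x).
have [N [mN N0 SN]] : {ae mu, forall x, `[0, L] x -> S x \is a fin_num}.
  by apply: integrable_ae.
have SE x : `[0, L] x -> ~ N x -> S x = (s x)%:E.
  move=> xL Nx; rewrite /s fineK //; apply: contrapT => H; apply: Nx; apply: SN.
  by move=> /= /(_ xL).
have s0 x : 0 <= s x by exact: fine_ge0.
have ls : L1per L s.
  apply: (le_integrable _ _ _ intS) => //.
    by apply/measurable_EFinP; apply: measurableT_comp mS; exact: fine_measurable.
  move=> x xL; rewrite /= ger0_norm // gee0_abs // /s.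
  by case: (S x) (S0 x).
have ds n x : `[0, L] x -> ~ N x -> `|gn n.+1 x - gn n x| <= Num.sqrt (s x) * 2^-1 ^+ n.
  move=> xL Nx.
  have es : e n x <= s x.
    rewrite -lee_fin -SE //; apply: le_trans (nneseries_lim_ge n.+1 _); last first.
      by move=> i _ _; rewrite lee_fin.
    rewrite big_nat_recr //= leeDr //.
    by apply: sume_ge0 => i _; rewrite lee_fin.
  have h0 : 0 <= 2^-1 ^+ n :> R by rewrite exprn_ge0 // invr_ge0.
  rewrite -sqrtr_sqr -(ger0_norm h0) -[X in _ * X]sqrtr_sqr -sqrtrM //.
  rewrite ler_wsqrtr //; move: es; rewrite /e -expr2 => es.
  have -> : (2^-1 ^+ n) ^+ 2 = (4 ^+ n)^-1 :> R.
    by rewrite -exprM mulnC exprM -exprVn; congr (_ ^+ _); field.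
  by rewrite ler_pdivlMr ?exprn_gt0 // mulrC.
(* outside the null set [N] the sum [S] is finite and the limit exists *)
pose g x := if x \in N then 0 else limn (fun n => gn n x).
have gP x : `[0, L] x -> ~ N x -> gn n x @[n --> \oo] --> g x /\
    forall n, `|g x - gn n x| <= 2 * Num.sqrt (s x) * 2^-1 ^+ n.
  move=> xL Nx; have [l [ul lb]] := fast_cauchy (sqrtr_ge0 _) (fun n => ds n x xL Nx).
  have -> : g x = l; last by [].
  by rewrite /g memNset //; apply: (cvg_lim (@Rhausdorff R) ul).
have mg : measurable_fun `[0, L] g.
  apply: (@measurable_fun_cvg _ _ _ _ (fun n => gn n \_ (~` N))).
    move=> n; apply/measurable_restrict => //; first exact: measurableC.
    by apply: measurable_funS (L2per_meas (lgn n)) => // x [].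
  move=> x xL; have [xN|xN] := pselect (N x).
    rewrite (_ : (fun n => _) = cst 0).
      by rewrite /g mem_set //; exact: cvg_cst.
    by apply/funext => n; rewrite patchE memNset //=; apply.
  rewrite (_ : (fun n => _) = (fun n => gn n x)).
    by have [] := gP x xL xN.
  by apply/funext => n; rewrite patchE mem_set.
have dsq n : ae_on L (fun x => (g x - gn n x) ^+ 2 <= 4 * (4^-1 ^+ n) * s x).
  exists N; split => // x /= /not_implyP[xL H]; apply: contrapT => Nx; apply: H.
  have [_ /(_ n) H] := gP x xL Nx.
  rewrite -real_normK ?num_real //.
  apply: le_trans (_ : _ <= (2 * Num.sqrt (s x) * 2^-1 ^+ n) ^+ 2) _.
    by rewrite lerXn2r // nnegrE // !mulr_ge0 ?exprn_ge0 ?sqrtr_ge0 // invr_ge0.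
  rewrite !exprMn sqr_sqrtr // -exprM mulnC exprM.
  rewrite (_ : (2^-1 : R) ^+ 2 = 4^-1); last by field.
  by rewrite le_eqVlt; apply/orP; left; apply/eqP; ring.
have lg : L2per L g.
  split => //; apply: (@L1per_le _ _ _ (fun x => 2 * (gn 0%N x * gn 0%N x) + 8 * s x)).
  - exact: measurable_funX.
  - by apply: L1perD; apply: L1perZ => //; exact: L2per_L1perM.
  - apply: ae_on_mono (dsq 0%N) => x _; rewrite expr0 mulr1 ger0_norm ?sqr_ge0 //.
    move: (g x) (gn 0%N x) (s x) => a b c.
    by have := sqr_ge0 (a - b - b); nra.
exists g; split => //.
apply: (@squeeze_cvgr _ _ _ _ (cst 0) (fun n => (4 * (4^-1 ^+ n)) * \int[mu]_(x in `[0, L]) s x)).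
- near=> n; rewrite ip_ge0 /= /ip -RintegralZl //; apply: le_ae_Rint.
  + by apply: L2per_L1perM; exact: L2perB.
  + exact: L1perZ.
  + by apply: ae_on_mono (dsq n) => x _; rewrite expr2.
- exact: cvg_cst.
- set I := \int[mu]_(x in `[0, L]) s x.
  suff : (4 * (4^-1 ^+ n) * I) @[n --> \oo] --> 4 * 0 * I by rewrite mulr0 mul0r.
  apply: cvgM; last exact: cvg_cst.
  apply: cvgM; first exact: cvg_cst.
  by apply: cvg_expr; rewrite ger0_norm ?invr_ge0 // invf_lt1 // ltr1n.
Unshelve. all: by end_near. Qed.

(** Expand [gn n] as [g - (g - gn n)]. *)
Lemma ip_cvg L (gn : nat -> R -> R) g : L2per L g -> (forall n, L2per L (gn n)) ->
  ip L (fun x => g x - gn n x) (fun x => g x - gn n x) @[n --> \oo] --> (0 : R) ->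
  ip L (gn n) (gn n) @[n --> \oo] --> ip L g g.
Proof.
move=> lg lgn gng.
pose d n := ip L (fun x => g x - gn n x) (fun x => g x - gn n x).
pose c n := ip L g (fun x => g x - gn n x).
have c_cvg : c n @[n --> \oo] --> (0 : R).
  apply/norm_cvg0P.
  apply: (@squeeze_cvgr _ _ _ _ (cst 0) (fun n => Num.sqrt (ip L g g * d n))).
  - near=> n; rewrite normr_ge0 /= -sqrtr_sqr ler_wsqrtr //.
    by apply: cauchy_schwarz => //; exact: L2perB.
  - exact: cvg_cst.
  - rewrite -[X in _ --> X]sqrtr0; apply: continuous_cvg; first exact: sqrt_continuous.
    by rewrite -[X in _ --> X](mulr0 (ip L g g)); apply: cvgM => //; exact: cvg_cst.
have -> : (fun n => ip L (gn n) (gn n)) = (fun n => ip L g g - 2 * c n + d n).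
  apply/funext => n.
  have lgd : L2per L (fun x => g x - gn n x) by exact: L2perB.
  transitivity (ip L (fun x => 1 * g x + (-1) * (g x - gn n x)) (fun x => 1 * g x + (-1) * (g x - gn n x))).
    by apply: eq_Rint => x _; ring.
  by rewrite ip_comb // -/(d n) -/(c n); ring.
rewrite -[X in _ --> X]addr0 -[X in _ --> X + _]subr0 -[X in _ --> _ - X + _](mulr0 2).
apply: cvgD => //; apply: cvgB; first exact: cvg_cst.
by apply: cvgM => //; exact: cvg_cst.
Unshelve. all: by end_near. Qed.

(** By Cauchy-Schwarz the defect in the defining identity is at most a multiple
    of the two L^2 distances. *)
Lemma is_wderiv_lim L (fn gn : nat -> R -> R) f g :
  L2per L f -> L2per L g -> (forall n, L2per L (fn n)) ->
  (forall n, is_wderiv L (fn n) (gn n)) ->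
  ip L (fun x => f x - fn n x) (fun x => f x - fn n x) @[n --> \oo] --> (0 : R) ->
  ip L (fun x => g x - gn n x) (fun x => g x - gn n x) @[n --> \oo] --> (0 : R) ->
  is_wderiv L f g.
Proof.
move=> lf lg lfn wn cf cg; split => // phi tphi.
have lgn n : L2per L (gn n) by case: (wn n).
have lphi : L2per L phi by apply: continuous_L2per; exact: testC1per_continuous tphi.
have ldphi : L2per L (derive1 phi) by apply: continuous_L2per; case: tphi.
apply/eqP; rewrite -addr_eq0 -/(ip L f (derive1 phi)) -/(ip L g phi).
set a := (X in X == 0).
rewrite -sqrf_eq0 eq_le sqr_ge0 andbT.
pose F n := ip L (fun x => f x - fn n x) (fun x => f x - fn n x).
pose G n := ip L (fun x => g x - gn n x) (fun x => g x - gn n x).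
have aE n : a ^+ 2 <= 2 * (F n * ip L (derive1 phi) (derive1 phi)) + 2 * (G n * ip L phi phi).
  have -> : a = ip L (fun x => f x - fn n x) (derive1 phi) + ip L (fun x => g x - gn n x) phi.
    rewrite /a; have := (wn n).2 _ tphi; rewrite -/(ip L (fn n) (derive1 phi)) -/(ip L (gn n) phi) => E.
    have B h1 h2 k : L2per L h1 -> L2per L h2 -> L2per L k ->
        ip L (fun x => h1 x - h2 x) k = ip L h1 k - ip L h2 k.
      move=> l1 l2 lk; under [X in ip L X k = _]eq_fun do rewrite -mulN1r.
      by rewrite ipDl ?ipZl ?mulN1r //; exact: L2perZ.
    by rewrite !B // E; ring.
  have := cauchy_schwarz (L2perB lf (lfn n)) ldphi.
  have := cauchy_schwarz (L2perB lg (lgn n)) lphi.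
  rewrite -/(F n) -/(G n); move: (ip L _ phi) (ip L _ (derive1 phi)) => u v.
  have := sqr_ge0 (u - v); nra.
have : (2 * (F n * ip L (derive1 phi) (derive1 phi)) + 2 * (G n * ip L phi phi)) @[n --> \oo] --> (0 : R).
  rewrite (_ : 0 = 2 * (0 * ip L (derive1 phi) (derive1 phi)) + 2 * (0 * ip L phi phi)); last by rewrite !mul0r !mulr0 addr0.
  by apply: cvgD; (apply: cvgM; [exact: cvg_cst|apply: cvgM; [|exact: cvg_cst]]).
move=> H; rewrite -(cvg_lim (@Rhausdorff R) H); apply: limr_ge; first by apply/cvg_ex; exists 0.
by near=> n.
Unshelve. all: by end_near. Qed.

End L2Estimates.

(** * Reflection and periodization *)

Section Geometry.
Context {R : realType}.
Local Open Scope classical_set_scope.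
Notation mu := (@lebesgue_measure R).
Implicit Types (L a b x y : R) (f g h V : R -> R).

(** Lebesgue measure is determined by its values on half-open intervals. *)
Lemma lebesgue_preimage (phi : measurableTypeR R -> measurableTypeR R) :
  measurable_fun setT phi ->
  (forall a b, mu (phi @^-1` `]a, b]) = mu `]a, b]) ->
  forall A, measurable A -> mu (phi @^-1` A) = mu A.
Proof.
move=> mphi phiE A mA.
pose mx := isMeasurableFun.Build _ _ _ _ _ mphi.
pose pk : {mfun _ >-> _} := HB.pack phi mx.
by apply/esym/(@lebesgue_measure_unique _ (pushforward mu pk)) => // X [[a b] _ <-]; exact/esym/phiE.
Qed.

Lemma measurable_refl L : measurable_fun [set: measurableTypeR R]
  ((fun x : R => L - x) : measurableTypeR R -> measurableTypeR R).
Proof.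
apply: continuous_measurable_fun => x; apply: cvgB; first exact: cvg_cst.
exact: cvg_id.
Qed.

Lemma lebesgue_refl L A : measurable A -> mu ((fun x : R => L - x) @^-1` A) = mu A.
Proof.
apply: (@lebesgue_preimage (fun x : R => L - x)); first exact: measurable_refl.
move=> a b.
have -> : (fun x : R => L - x) @^-1` `]a, b] = `[L - b, L - a[.
  by apply/seteqP; split => x /=; rewrite !in_itv /=; lra.
rewrite !lebesgue_measure_itv /= !lte_fin ltrD2l ltrN2; case: ifP => // _.
by rewrite -!EFinB; congr EFin; ring.
Qed.

Lemma lebesgue_shift c A : measurable A -> mu ((fun x : R => x + c) @^-1` A) = mu A.
Proof.
apply: (@lebesgue_preimage (fun x : R => x + c)).
  apply: continuous_measurable_fun => x; apply: cvgD; first exact: cvg_id.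
  exact: cvg_cst.
move=> a b.
have -> : (fun x : R => x + c) @^-1` `]a, b] = `]a - c, b - c].
  by apply/seteqP; split => x /=; rewrite !in_itv /=; lra.
rewrite !lebesgue_measure_itv /= !lte_fin ltrD2r; case: ifP => // _.
by rewrite -!EFinB; congr EFin; ring.
Qed.

Lemma refl_period L : (fun x : R => L - x) @^-1` `[0, L] = `[0, L].
Proof. by apply/seteqP; split => x /=; rewrite !in_itv /=; lra. Qed.

Lemma ae_on_refl L (P : R -> Prop) : ae_on L P -> ae_on L (fun x => P (L - x)).
Proof.
move=> [N [mN N0 PN]]; exists ((fun x : R => L - x) @^-1` N); split.
- by rewrite -(setTI (_ @^-1` _)); apply: measurable_refl.
- by rewrite lebesgue_refl.
- move=> x /= H; apply: PN => /= H2; apply: H => xL; apply: H2.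
  by move: xL; rewrite !in_itv /=; lra.
Qed.

Lemma measurable_fun_refl L f : measurable_fun `[0, L] f ->
  measurable_fun `[0, L] (fun x => f (L - x)).
Proof.
move=> mf; apply: (measurable_comp (F := `[0, L])) mf _ => //; last first.
  by apply: measurable_funTS; exact: measurable_refl.
by move=> _ [x /= + <-]; rewrite !in_itv /=; lra.
Qed.

(** Change variables in the positive and in the negative part. *)
Lemma integral_refl L (F : R -> \bar R) : measurable_fun `[0, L] F ->
  (\int[mu]_(x in `[0%R, L]) F (L - x)%R = \int[mu]_(x in `[0%R, L]) F x)%E.
Proof.
move=> mF.
have H (G : R -> \bar R) : measurable_fun `[0, L] G -> (forall x, 0%E <= G x)%E ->
    (\int[mu]_(x in `[0%R, L]) G (L - x)%R = \int[mu]_(x in `[0%R, L]) G x)%E.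
  move=> mG G0.
  pose phi : measurableTypeR R -> measurableTypeR R := fun x => L - x.
  have -> : (\int[mu]_(x in `[0%R, L]) G (L - x)%R = \int[mu]_(x in phi @^-1` `[0%R, L]) (G \o phi) x)%E.
    by rewrite /phi refl_period.
  rewrite -ge0_integral_pushforward //; last exact: measurable_refl.
  apply: eq_measure_integral; first exact: measurable_refl.
  by move=> mphi A mA _; exact: (lebesgue_refl L mA).
rewrite integralE [RHS]integralE; congr (_ - _)%E.
- rewrite -(H (F^\+)%E) //; last exact: measurable_funepos.
  by apply: eq_integral => x _; rewrite !funeposE.
- rewrite -(H (F^\-)%E) //; last exact: measurable_funeneg.
  by apply: eq_integral => x _; rewrite !funenegE.
Qed.

Lemma Rint_refl L f : measurable_fun `[0, L] f ->
  \int[mu]_(x in `[0, L]) f (L - x) = \int[mu]_(x in `[0, L]) f x.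
Proof.
by move=> mf; congr fine; apply: (integral_refl (F := EFin \o f)); exact/measurable_EFinP.
Qed.

Lemma L1per_refl L f : L1per L f -> L1per L (fun x => f (L - x)).
Proof.
move=> /integrableP[/measurable_EFinP mf foo]; apply/integrableP; split.
  by apply/measurable_EFinP; exact: measurable_fun_refl.
rewrite (integral_refl (F := fun x => `|(f x)%:E|%E)) //.
by apply/measurable_EFinP; apply: measurableT_comp.
Qed.

Lemma L2per_refl L f : L2per L f -> L2per L (fun x => f (L - x)).
Proof.
move=> [mf f2]; split; first exact: measurable_fun_refl.
exact: (L1per_refl (f := fun x => f x ^+ 2)).
Qed.

Lemma ip_refl L f g : L2per L f -> L2per L g ->
  ip L (fun x => f (L - x)) (fun x => g (L - x)) = ip L f g.
Proof.
move=> [mf _] [mg _]; rewrite /ip (Rint_refl (f := fun x => f x * g x)) //.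
exact: measurable_funM.
Qed.

Lemma test_refl L phi : testC1per L phi ->
  testC1per L (fun x => phi (L - x)) /\
  derive1 (fun x => phi (L - x)) = (fun x => - derive1 phi (L - x)).
Proof.
move=> tphi; have [pp _ cp] := tphi.
have d x : is_derive x 1 (fun x => phi (L - x)) (- derive1 phi (L - x)).
  rewrite -mulrN1; apply: (@is_derive1_comp _ phi (fun y => L - y)).
    exact: testC1per_is_derive tphi _.
  by rewrite -[-1]add0r; apply: is_deriveB.
split; last exact: is_derive_derive1.
apply: testC1per_primitive d _; last first.
  by move=> x; rewrite -[in RHS](subrK L (L - x)) pp; congr phi; ring.
move=> x; apply: cvgN; apply: (@continuous_comp _ _ _ (fun y => L - y) (derive1 phi)).
  by apply: cvgB; [exact: cvg_cst|exact: cvg_id].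
exact: cp.
Qed.

(** Reflecting the test functions shows that [- g (L - x)] is another weak
    derivative of the even function [f]; conclude by uniqueness. *)
Lemma wderiv_odd L f g : 0 < L -> L2per L f -> is_wderiv L f g ->
  ae_on L (fun x => f (L - x) = f x) -> ae_on L (fun x => g (L - x) = - g x).
Proof.
move=> L0 lf wg fe; have [lg fg] := wg.
have w2 : is_wderiv L f (fun x => - g (L - x)).
  split.
    have := L2perZ (-1) (L2per_refl lg).
    by under [X in L2per L X -> _]eq_fun do rewrite mulN1r.
  move=> phi tphi; have [tr dr] := test_refl tphi.
  have lp : L2per L phi by apply: continuous_L2per; exact: testC1per_continuous tphi.
  have ldp : L2per L (derive1 phi) by apply: continuous_L2per; case: tphi.
  have := fg _ tr; rewrite dr.
  rewrite -(Rint_refl (f := fun x => f x * - derive1 phi (L - x))); last first.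
    by apply: measurable_funM; [exact: L2per_meas|apply: measurableT_comp => //; exact: L2per_meas (L2per_refl ldp)].
  rewrite -(Rint_refl (f := fun x => g x * phi (L - x))); last first.
    by apply: measurable_funM; [exact: L2per_meas|exact: L2per_meas (L2per_refl lp)].
  under eq_Rintegral do rewrite subKr.
  under [in RHS]eq_Rintegral do rewrite subKr.
  have -> : \int[mu]_(x in `[0, L]) (f (L - x) * - derive1 phi x) = - ip L f (derive1 phi).
    rewrite -[RHS]mulN1r -ipZr //; apply: eq_ae_Rint.
    - by apply: measurable_funM; [exact: L2per_meas (L2per_refl lf)|apply: measurableT_comp => //; exact: L2per_meas].
    - by apply: measurable_funM; [exact: L2per_meas|exact: L2per_meas (L2perZ (-1) ldp)].
    - by apply: ae_on_mono fe => x _ ->; rewrite mulN1r.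
  move=> /oppr_inj; rewrite /ip => ->.
  have -> : \int[mu]_(x in `[0, L]) (- g (L - x) * phi x) =
      - \int[mu]_(x in `[0, L]) (g (L - x) * phi x).
    rewrite -[RHS]mulN1r -RintegralZl //; last exact: L2per_L1perM (L2per_refl lg) lp.
    by apply: eq_Rint => x _; ring.
  by rewrite opprK.
apply: ae_on_mono (wderiv_unique L0 lf wg w2) => x _ ->.
by rewrite opprK.
Qed.

(** The representative of [x] modulo [L] in [0 <= _ < L]. *)
Definition wrap L x := x - (Num.floor (x / L))%:~R * L.

Definition periodize L V x := V (wrap L x).

Lemma wrap_itv L x : 0 < L -> 0 <= wrap L x < L.
Proof.
move=> L0; have := floor_itv (x / L).
rewrite ler_pdivlMr // ltr_pdivrMr // intrD mulrDl mul1r /wrap.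
by move: (_ * L) => t; lra.
Qed.

Lemma wrap_shift L x (k : int) : 0 < L -> 0 <= x - k%:~R * L < L -> wrap L x = x - k%:~R * L.
Proof.
move=> L0 H; rewrite /wrap (@floor_def _ _ k) //.
by rewrite ler_pdivlMr // ltr_pdivrMr // intrD mulrDl mul1r; move: H; move: (_ * L) => t; lra.
Qed.

Lemma wrap_id L x : 0 < L -> 0 <= x < L -> wrap L x = x.
Proof. by move=> L0 xL; rewrite (@wrap_shift _ _ 0) // mul0r subr0. Qed.

Lemma wrapD L x (k : int) : 0 < L -> wrap L (x + k%:~R * L) = wrap L x.
Proof.
move=> L0; have E : x + k%:~R * L - (Num.floor (x / L) + k)%:~R * L = wrap L x.
  by rewrite /wrap intrD; ring.
by rewrite (@wrap_shift _ _ (Num.floor (x / L) + k)) // E wrap_itv.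
Qed.

Lemma wrapDL L x : 0 < L -> wrap L (x + L) = wrap L x.
Proof. by move=> L0; rewrite -(wrapD x 1 L0) mulr1z mul1r. Qed.

Lemma periodize_periodic L V : 0 < L -> periodic (periodize L V) L.
Proof. by move=> L0 x; rewrite /periodize wrapDL. Qed.

Lemma periodizeE L V x : 0 < L -> V L = V 0 -> 0 <= x <= L -> periodize L V x = V x.
Proof.
move=> L0 VL /andP[x0]; rewrite le_eqVlt => /predU1P[->|xL]; last first.
  by rewrite /periodize wrap_id // x0.
by rewrite /periodize -[X in wrap _ X](add0r L) wrapDL // wrap_id // lexx.
Qed.

Lemma periodic_wrap L f x : periodic f L -> f x = f (wrap L x).
Proof.
move=> fL.
have pos (n : nat) y : f (y + n%:R * L) = f y.
  by rewrite mulr_natl; apply: periodicn.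
rewrite /wrap; case: (Num.floor _) => n.
  by rewrite -[in LHS](subrK (n%:R * L) x) pos.
by rewrite NegzE mulrNz mulNr opprK pos.
Qed.

Lemma periodize_continuous L V : 0 < L -> {within `[0, L], continuous V} ->
  V L = V 0 -> continuous (periodize L V).
Proof.
move=> L0 cV VL z.
have modulus p e : 0 <= p <= L -> 0 < e ->
    exists2 d, 0 < d & forall y, 0 <= y <= L -> `|p - y| < d -> `|V p - V y| < e.
  move=> pL e0; have /subspace_continuousP/(_ p) := cV.
  rewrite /= in_itv /= => /(_ pL) /cvgrPdist_lt/(_ _ e0).
  rewrite near_withinE => /nbhs_ballP[d /= d0 hd].
  by exists d => // y yL py; apply: hd => //; rewrite /= in_itv.
apply/cvgrPdist_lt => e e0.
set k := Num.floor (z / L).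
have zE : wrap L z = z - k%:~R * L by [].
have := wrap_itv z L0; rewrite zE => /andP[z0 zL].
(* near a multiple of [L] the values come from both ends of the period, which
   [V L = V 0] makes match; elsewhere [wrap] is locally a translation *)
have [zz|zn0] := eqVneq (wrap L z) 0.
- have [d1 d10 H1] := modulus 0 e (introT andP (conj (lexx 0) (ltW L0))) e0.
  have [d2 d20 H2] := modulus L e (introT andP (conj (ltW L0) (lexx L))) e0.
  have kz : z = k%:~R * L by apply/eqP; rewrite -subr_eq0 -zE zz.
  near=> x.
  have x1 : `|z - x| < d1 by near: x; exact: cvgr_dist_lt.
  have x2 : `|z - x| < d2 by near: x; exact: cvgr_dist_lt.
  have x3 : `|z - x| < L by near: x; exact: cvgr_dist_lt.
  have [zx|xz] := leP z x.
    have wx : wrap L x = x - z.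
      by rewrite (@wrap_shift _ _ k) -?kz //; move: x3; rewrite ltr_norml; lra.
    rewrite /periodize zz wx; apply: H1; last by rewrite sub0r opprB.
    by move: x3; rewrite ltr_norml; lra.
  have wx : wrap L x = x - z + L.
    have E : x - (k - 1)%:~R * L = x - z + L by rewrite kz intrD; ring.
    rewrite -E; apply: wrap_shift => //; rewrite E.
    by move: x3; rewrite ltr_norml; lra.
  rewrite /periodize zz wx -VL; apply: H2; last first.
    by rewrite (_ : L - (x - z + L) = z - x); last ring.
  by move: x3; rewrite ltr_norml; lra.
- have {}z0 : 0 < z - k%:~R * L by rewrite lt_neqAle z0 eq_sym -zE zn0.
  have [d d0 H] := modulus (wrap L z) e (introT andP (conj (ltW (eq_ind_r (fun t => 0 < t) z0 zE)) (ltW (eq_ind_r (fun t => t < L) zL zE)))) e0.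
  near=> x.
  have x1 : `|z - x| < d by near: x; exact: cvgr_dist_lt.
  have x2 : `|z - x| < z - k%:~R * L by near: x; exact: cvgr_dist_lt.
  have x3 : `|z - x| < L - (z - k%:~R * L) by near: x; apply: cvgr_dist_lt; rewrite ?subr_gt0.
  have wx : 0 <= x - k%:~R * L < L.
    by move: x2 x3; rewrite !ltr_norml; move: (k%:~R * L) => t; lra.
  rewrite /periodize (@wrap_shift _ x k) //; apply: H.
    by move: wx; lra.
  by rewrite zE (_ : _ - _ = z - x) //; ring.
Unshelve. all: by end_near. Qed.

(** The exceptional set is covered by the translates of a null set by the
    multiples of [L], which are countably many. *)
Lemma ae_periodic L f h : 0 < L -> periodic f L -> periodic h L ->
  ae_on L (fun x => f x = h x) -> {ae mu, forall x, f x = h x}.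
Proof.
move=> L0 pf ph [N [mN N0 fN]].
pose T (k : int) := (fun x : R => x + (- k%:~R * L)) @^-1` N.
have NT k : mu.-negligible (T k).
  exists (T k); split => //.
    rewrite -(setTI (T k)); apply: (continuous_measurable_fun _ measurableT mN).
    by move=> x; apply: cvgD; [exact: cvg_id|exact: cvg_cst].
  by rewrite lebesgue_shift.
have U : mu.-negligible (\bigcup_n T (Posz n) `|` \bigcup_n T (Negz n)).
  by apply: negligibleU; apply: negligible_bigcup => n; exact: NT.
apply: negligibleS U => x /= H.
have : N (wrap L x).
  apply: fN => /= H2; apply: H; rewrite (periodic_wrap x pf) (periodic_wrap x ph); apply: H2.
  by have /andP[a b] := wrap_itv x L0; rewrite in_itv /= a ltW.
rewrite /wrap; case: (Num.floor _) => n Nx; [left|right]; exists n => //=; rewrite /T /=.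
- by rewrite mulNr.
- by rewrite mulNr.
Qed.

(** Both sides are continuous and they agree almost everywhere. *)
Lemma rep_even L f g C : 0 < L -> periodic f L -> L2per L g ->
  {ae mu, forall x, f (- x) = f x} ->
  ae_on L (fun x => f x = C + prim g x) ->
  forall x, 0 <= x <= L -> C + prim g (L - x) = C + prim g x.
Proof.
move=> L0 pf lg fe fE x xL; apply/eqP; rewrite -subr_eq0; apply/eqP.
pose h x := (C + prim g (L - x)) - (C + prim g x).
have cp := prim_within_continuous (ltW L0) (L2per_L1per lg).
apply: (@within_continuous_eq0 _ L h L0) => //.
  apply/subspace_continuousP => y yL; apply: cvgB; apply: cvgD; try exact: cvg_cst; last first.
    by move/subspace_continuousP : cp; exact.
  apply/cvgrPdist_lt => e e0.
  have yL' : `[0, L] (L - y) by move: yL; rewrite /= !in_itv /=; lra.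
  have /subspace_continuousP/(_ _ yL')/cvgrPdist_lt/(_ _ e0) := cp.
  rewrite !near_withinE => /nbhs_ballP[d /= d0 hd]; apply/nbhs_ballP; exists d => //= z yz zL.
  apply: hd; last by move: zL; rewrite /= !in_itv /=; lra.
  by rewrite /ball /= (_ : _ - _ = - (y - z)) ?normrN //; ring.
have fe' : ae_on L (fun x => f (L - x) = f x).
  by apply: ae_mono fe => y fy _; rewrite addrC pf.
have H := ae_on_mono2 (fun x _ u v => conj u v) fE (ae_on_refl fE).
by apply: ae_on_mono2 fe' H => y _ e1 [e2 e3]; rewrite /h -e2 -e3 e1 subrr.
Qed.

Lemma even_ae_on L f : periodic f L -> {ae mu, forall x, f (- x) = f x} ->
  ae_on L (fun x => f (L - x) = f x).
Proof. by move=> pf; apply: ae_mono => y fy _; rewrite addrC pf. Qed.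

Lemma periodize_even L V : 0 < L -> V L = V 0 ->
  (forall x, 0 <= x <= L -> V (L - x) = V x) -> forall x, periodize L V (- x) = periodize L V x.
Proof.
move=> L0 VL Ve x; rewrite /periodize.
have [xx|xn0] := eqVneq (wrap L x) 0.
  have E : - x = 0 + (- Num.floor (x / L))%:~R * L.
    by move/eqP: xx; rewrite /wrap subr_eq0 => /eqP {1}->; rewrite mulrNz; ring.
  by rewrite xx E wrapD // wrap_id // lexx.
have /andP[x0 xL] := wrap_itv x L0.
have {}x0 : 0 < wrap L x by rewrite lt_neqAle eq_sym xn0.
have E : - x - (- Num.floor (x / L) - 1)%:~R * L = L - wrap L x.
  by rewrite /wrap intrD mulrNz; ring.
rewrite (@wrap_shift _ (- x) (- Num.floor (x / L) - 1)) // E; last by move: x0 xL; lra.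
by apply: Ve; rewrite !ltW.
Qed.

End Geometry.

(** * Mass and energy of pairs of functions *)

Section Functionals.
Context {R : realType}.
Local Open Scope classical_set_scope.
Notation mu := (@lebesgue_measure R).
Implicit Types (L x y M e alpha omega tau : R) (f g h : R -> R) (F G : bool -> R -> R).

Definition hypot (a b : R) := Num.sqrt (a ^+ 2 + b ^+ 2).

Lemma hypot_ge0 a b : 0 <= hypot a b. Proof. exact: sqrtr_ge0. Qed.

Lemma sqr_hypot a b : hypot a b ^+ 2 = a ^+ 2 + b ^+ 2.
Proof. by rewrite sqr_sqrtr // addr_ge0 ?sqr_ge0. Qed.

Lemma hypot_cauchy_schwarz a b c d : a * c + b * d <= hypot a b * hypot c d.
Proof.
apply: le_trans (ler_norm _) _.
rewrite -sqrtr_sqr /hypot -sqrtrM ?addr_ge0 ?sqr_ge0 // ler_wsqrtr //.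
by have := sqr_ge0 (a * d - b * c); nra.
Qed.

Lemma hypotZ c a b : 0 <= c -> hypot (c * a) (c * b) = c * hypot a b.
Proof.
by move=> c0; rewrite /hypot !exprMn -mulrDr sqrtrM ?sqr_ge0 // sqrtr_sqr ger0_norm.
Qed.

Lemma hypot_le a b M : `|a| <= M -> `|b| <= M -> hypot a b <= 2 * M.
Proof.
move=> aM bM; have M0 : 0 <= M by exact: le_trans aM.
rewrite -(@ler_pXn2r _ 2) ?nnegrE ?hypot_ge0 ?mulr_ge0 // sqr_hypot.
rewrite -(real_normK (num_real a)) -(real_normK (num_real b)).
by move: (normr_ge0 a) (normr_ge0 b); nra.
Qed.

(** Young's inequality: the tangent to [t |-> t `^ p] at [a] lies below it. *)
Lemma powR_tangent (a b p : R) : 1 < p -> 0 <= a -> 0 <= b ->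
  a `^ p + p * a `^ (p - 1) * (b - a) <= b `^ p.
Proof.
move=> p1 a0 b0; have p0 : 0 < p by exact: lt_trans p1.
have pn0 : p != 0 by rewrite gt_eqF.
have q0 : 0 < p - 1 by rewrite subr_gt0.
have qn0 : p - 1 != 0 by rewrite gt_eqF.
have := @conjugate_powR R b (a `^ (p - 1)) p (p / (p - 1)) b0 (powR_ge0 _ _) p0 (divr_gt0 p0 q0).
have -> : p^-1 + (p / (p - 1))^-1 = 1 by field; apply/andP; split.
move=> /(_ erefl); rewrite -powRrM.
have -> : (p - 1) * (p / (p - 1)) = p by field.
have -> : p * a `^ (p - 1) * (b - a) = p * (b * a `^ (p - 1)) - p * (a * a `^ (p - 1)) by ring.
rewrite mulr_powRB1 // => H.
have {}H : p * (b * a `^ (p - 1)) <= b `^ p + a `^ p * (p - 1).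
  rewrite -(ler_pM2l (_ : 0 < p^-1)) ?invr_gt0 // mulKf //.
  apply: le_trans H _; rewrite le_eqVlt; apply/orP; left; apply/eqP.
  by field; apply/andP; split.
by move: H; move: (b * _) (a `^ p) (b `^ p) => u v w; lra.
Qed.

(** The tangent inequality for [|z|^p], from [powR_tangent] at [|z|] and
    Cauchy-Schwarz in the plane. *)
Lemma hypot_tangent alpha a b c d : 0 < alpha ->
  hypot a b `^ (alpha + 2) + (alpha + 2) * (hypot a b `^ alpha * (a * c + b * d))
  <= hypot (a + c) (b + d) `^ (alpha + 2).
Proof.
move=> al0; have an0 : alpha != 0 by rewrite gt_eqF.
have p1 : 1 < alpha + 2 by lra.
have := hypot_ge0 a b; rewrite le_eqVlt => /predU1P[E|r0].
  by rewrite -E !powR0 ?gt_eqF ?powR_ge0 ?addr_gt0 //; rewrite mul0r mulr0 addr0 powR_ge0.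
apply: le_trans (powR_tangent p1 (ltW r0) (hypot_ge0 (a + c) (b + d))).
rewrite lerD2l -!mulrA ler_pM2l; last lra.
have -> : alpha + 2 - 1 = alpha + 1 by ring.
rewrite powRD; last by apply/implyP => _; rewrite gt_eqF.
rewrite powRr1 ?hypot_ge0 // -mulrA ler_wpM2l ?powR_ge0 //.
have := hypot_cauchy_schwarz a b (a + c) (b + d).
by have := sqr_hypot a b; move: (hypot a b) (hypot (a + c) (b + d)) => r s; nra.
Qed.

(** The modulus of the complex-valued function with parts [F true], [F false]. *)
Definition cmod F x := hypot (F true x) (F false x).

Definition mass L alpha F := \int[mu]_(x in `[0, L]) (cmod F x `^ (alpha + 2)).

(** Up to the factor [alpha + 2], the differential of [mass] at [F] in the
    direction [G]. *)
Definition mass_form L alpha F G := \int[mu]_(x in `[0, L])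
  (cmod F x `^ alpha * (F true x * G true x + F false x * G false x)).

Definition lincomb (s t : R) F G : bool -> R -> R := fun b x => s * F b x + t * G b x.

Definition bounded2 L F M := forall b, ae_on L (fun x => `|F b x| <= M).

Definition meas2 L F := forall b, measurable_fun `[0, L] (F b).

Lemma bounded2_and L F M : bounded2 L F M ->
  ae_on L (fun x => `|F true x| <= M /\ `|F false x| <= M).
Proof.
by move=> bF; apply: ae_on_mono2 (bF true) (bF false) => x _.
Qed.

Lemma measurable_cmod L F : meas2 L F -> measurable_fun `[0, L] (cmod F).
Proof.
move=> mF; rewrite -[cmod F]/((@Num.sqrt R) \o (fun x => F true x ^+ 2 + F false x ^+ 2)).
apply: measurableT_comp.
  by apply: continuous_measurable_fun; exact: sqrt_continuous.
by apply: measurable_funD; apply: measurable_funX; exact: mF.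
Qed.

Lemma measurable_cmod_powR L F p : meas2 L F -> measurable_fun `[0, L] (fun x => cmod F x `^ p).
Proof.
move=> mF; rewrite -[X in measurable_fun _ X]/((@powR R ^~ p) \o cmod F).
by apply: measurableT_comp; [exact: measurable_powR|exact: measurable_cmod].
Qed.

Lemma cmod_powR_le L F M p : 0 <= p -> bounded2 L F M ->
  ae_on L (fun x => `|cmod F x `^ p| <= (2 * M) `^ p).
Proof.
move=> p0 /bounded2_and; apply: ae_on_mono => x _ [h1 h2].
have M0 : 0 <= M by exact: le_trans h1.
rewrite ger0_norm ?powR_ge0 //; apply: ge0_ler_powR; rewrite ?nnegrE ?hypot_ge0 ?mulr_ge0 //.
exact: hypot_le.
Qed.

Lemma L1per_cmod_powR L F M p : 0 <= p -> meas2 L F -> bounded2 L F M ->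
  L1per L (fun x => cmod F x `^ p).
Proof.
by move=> p0 mF bF; apply: (L1per_bounded (measurable_cmod_powR p mF) (cmod_powR_le p0 bF)).
Qed.

Lemma measurable_mass_form L alpha F G : meas2 L F -> meas2 L G ->
  measurable_fun `[0, L] (fun x => cmod F x `^ alpha * (F true x * G true x + F false x * G false x)).
Proof.
move=> mF mG; apply: measurable_funM; first exact: measurable_cmod_powR.
by apply: measurable_funD; apply: measurable_funM.
Qed.

Lemma mass_form_le L alpha F G M e : 0 < alpha -> bounded2 L F M -> bounded2 L G e ->
  ae_on L (fun x => `|cmod F x `^ alpha * (F true x * G true x + F false x * G false x)|
    <= (2 * M) `^ alpha * (2 * M * e)).
Proof.
move=> al0 bF bG.
apply: ae_on_mono2 (ae_on_mono2 (fun x _ u v => conj u v) (bounded2_and bF) (bounded2_and bG)) (cmod_powR_le (ltW al0) bF).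
move=> x _ [[f1 f2] [g1 g2]] H; rewrite normrM ler_pM //.
have M0 : 0 <= M by exact: le_trans f1.
apply: le_trans (ler_normD _ _) _; rewrite !normrM.
rewrite (_ : 2 * M * e = M * e + M * e); last ring.
by apply: lerD; apply: ler_pM.
Qed.

Lemma L1per_mass_form L alpha F G M e : 0 < alpha -> meas2 L F -> meas2 L G ->
  bounded2 L F M -> bounded2 L G e ->
  L1per L (fun x => cmod F x `^ alpha * (F true x * G true x + F false x * G false x)).
Proof. by move=> a0 mF mG bF bG; apply: (L1per_bounded (measurable_mass_form _ mF mG) (mass_form_le a0 bF bG)). Qed.

(** Integrate [hypot_tangent]: [mass] is convex, so it lies above its tangents. *)
Lemma mass_tangent L alpha F G M e t : 0 < alpha -> meas2 L F -> meas2 L G ->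
  bounded2 L F M -> bounded2 L G e ->
  mass L alpha F + t * ((alpha + 2) * mass_form L alpha F G) <= mass L alpha (lincomb 1 t F G).
Proof.
move=> al0 mF mG bF bG; have p0 : 0 <= alpha + 2 by lra.
have mS : meas2 L (lincomb 1 t F G).
  by move=> b; apply: measurable_funD; apply: measurable_funM.
have bS : bounded2 L (lincomb 1 t F G) (M + `|t| * e).
  move=> b; apply: ae_on_mono2 (bF b) (bG b) => x _ h1 h2.
  by rewrite /lincomb mul1r (le_trans (ler_normD _ _)) // lerD // normrM ler_wpM2l.
have lD := L1per_mass_form al0 mF mG bF bG.
rewrite /mass /mass_form mulrA -RintegralZl // -RintegralD //; last 2 first.
- exact: L1per_cmod_powR bF.
- exact: L1perZ.
apply: le_Rintegral => //.
- by apply: L1perD; [exact: L1per_cmod_powR bF|exact: L1perZ].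
- exact: L1per_cmod_powR bS.
- move=> x _; rewrite /cmod /lincomb !mul1r.
  apply: le_trans (hypot_tangent _ _ _ _ al0).
  by rewrite le_eqVlt; apply/orP; left; apply/eqP; ring.
Qed.

Lemma mass_scale L alpha F c : 0 <= c -> L1per L (fun x => cmod F x `^ (alpha + 2)) ->
  mass L alpha (fun b x => c * F b x) = c `^ (alpha + 2) * mass L alpha F.
Proof.
move=> c0 lF; rewrite /mass -RintegralZl //; apply: eq_Rint => x _.
by rewrite /cmod hypotZ // powRM // hypot_ge0.
Qed.

(** The tangent at [F] bounds the difference by the differential of [mass],
    which is bounded on bounded functions: [mass] is Lipschitz for the uniform
    norm there. *)
Lemma mass_close L alpha F F' M e : 0 < L -> 0 < alpha -> meas2 L F -> meas2 L F' ->
  bounded2 L F M -> bounded2 L F' M ->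
  bounded2 L (lincomb 1 (-1) F' F) e ->
  mass L alpha F - mass L alpha F' <= (alpha + 2) * ((2 * M) `^ alpha * (2 * M * e)) * L.
Proof.
move=> L0 al0 mF mF' bF bF' bd.
have md_ : meas2 L (lincomb 1 (-1) F' F).
  by move=> b; apply: measurable_funD; apply: measurable_funM.
have := mass_tangent 1 al0 mF md_ bF bd.
have -> : mass L alpha (lincomb 1 1 F (lincomb 1 (-1) F' F)) = mass L alpha F'.
  by apply: eq_Rint => x _; rewrite /cmod /lincomb; congr (hypot _ _ `^ _); ring.
have : - mass_form L alpha F (lincomb 1 (-1) F' F) <= ((2 * M) `^ alpha * (2 * M * e)) * L.
  rewrite -Rint_cst //; apply: le_trans (ler_norm _) _; rewrite normrN.
  have lD := L1per_mass_form al0 mF md_ bF bd.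
  apply: le_trans (le_normr_Rintegral _ lD) _ => //.
  apply: le_ae_Rint; [exact: integrable_norm|exact: L1per_cst|].
  exact: mass_form_le bF bd.
rewrite mul1r; move: (mass_form _ _ _ _) (mass _ _ _) (mass _ _ _) => d n1 n2.
move: (_ `^ alpha * _) => k H1 H2.
have : (alpha + 2) * - d <= (alpha + 2) * (k * L) by rewrite ler_wpM2l //; lra.
by rewrite mulrN mulrA; move: H2; lra.
Qed.

(** * Even periodic Sobolev functions with a chosen weak derivative *)

(** Carrying the weak derivative along makes the energy a quadratic form in the
    pair, free of the choice made by [wderiv]. *)
Definition even_H1 L f g := [/\ periodic f L, L2per L f, is_wderiv L f g &
  {ae mu, forall x, f (- x) = f x}].

Definition even_HH1 L F G := forall b, even_H1 L (F b) (G b).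

Lemma even_H1_lin L f g f' g' (s t : R) : even_H1 L f g -> even_H1 L f' g' ->
  even_H1 L (fun x => s * f x + t * f' x) (fun x => s * g x + t * g' x).
Proof.
move=> [pf lf [lg wf] ef] [pf' lf' [lg' wf'] ef']; split.
- by move=> x; rewrite pf pf'.
- by apply: L2perD; exact: L2perZ.
- split; first by apply: L2perD; exact: L2perZ.
  move=> phi tphi.
  have lp : L2per L phi by apply: continuous_L2per; exact: testC1per_continuous tphi.
  have ldp : L2per L (derive1 phi) by apply: continuous_L2per; case: tphi.
  rewrite -/(ip L (fun x => s * f x + t * f' x) _) -/(ip L (fun x => s * g x + t * g' x) _).
  rewrite !ipDl ?ipZl //; try exact: L2perZ.
  have := wf _ tphi; have := wf' _ tphi.
  by rewrite -/(ip L f _) -/(ip L g _) -/(ip L f' _) -/(ip L g' _) => -> ->; ring.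
- by apply: ae_mono2 ef ef' => x -> ->.
Qed.

Lemma even_HH1_lin L F G F' G' s t : even_HH1 L F G -> even_HH1 L F' G' ->
  even_HH1 L (lincomb s t F F') (lincomb s t G G').
Proof. by move=> a a' b; exact: even_H1_lin. Qed.

Lemma even_H1_scale L f g (s : R) : even_H1 L f g -> even_H1 L (fun x => s * f x) (fun x => s * g x).
Proof.
move=> a; have := even_H1_lin s 0 a a.
under [X in even_H1 _ X _]eq_fun do rewrite mul0r addr0.
by under [X in even_H1 _ _ X]eq_fun do rewrite mul0r addr0.
Qed.

Lemma even_HH1_scale L F G s : even_HH1 L F G ->
  even_HH1 L (fun b x => s * F b x) (fun b x => s * G b x).
Proof. by move=> a b; exact: even_H1_scale. Qed.

Lemma even_H1_L2 L f g : even_H1 L f g -> L2per L f /\ L2per L g.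
Proof. by case=> _ lf [lg _] _. Qed.

Lemma even_HH1_measurable L F G : even_HH1 L F G -> meas2 L F.
Proof. by move=> a b; have [/L2per_meas] := even_H1_L2 (a b). Qed.

Lemma even_H1_bounded L f g : 0 < L -> even_H1 L f g ->
  ae_on L (fun x => `|f x| <= Num.sqrt (2 / L * ip L f f + 2 * L * ip L g g)).
Proof.
move=> L0 [_ lf wf _]; have [C fE] := wderiv_rep L0 lf wf.
apply: ae_on_mono (fE) => x xL fE'; rewrite -sqrtr_sqr ler_wsqrtr // fE'.
by apply: sup_bound fE xL => //; case: wf.
Qed.

Lemma even_HH1_bounded L F G : 0 < L -> even_HH1 L F G -> exists M, bounded2 L F M.
Proof.
move=> L0 a.
exists (Num.max (Num.sqrt (2 / L * ip L (F true) (F true) + 2 * L * ip L (G true) (G true)))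
                (Num.sqrt (2 / L * ip L (F false) (F false) + 2 * L * ip L (G false) (G false)))).
case.
- by apply: ae_on_mono (even_H1_bounded L0 (a true)) => x _ h; rewrite le_max h.
- by apply: ae_on_mono (even_H1_bounded L0 (a false)) => x _ h; rewrite le_max h orbT.
Qed.

Lemma L1per_mass L alpha F G : 0 < L -> 0 < alpha -> even_HH1 L F G ->
  L1per L (fun x => cmod F x `^ (alpha + 2)).
Proof.
move=> L0 al0 a; have [M bF] := even_HH1_bounded L0 a.
by apply: L1per_cmod_powR bF; [lra|exact: even_HH1_measurable a].
Qed.

(** The bilinear form whose quadratic form is twice the energy. *)
Definition energy_form L omega F G F' G' :=
  ip L (G true) (G' true) + ip L (G false) (G' false) +
  omega * (ip L (F true) (F' true) + ip L (F false) (F' false)).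

Definition energy L omega F G := 2^-1 * energy_form L omega F G F G.

Lemma energy_lin L omega F G F' G' s t : even_HH1 L F G -> even_HH1 L F' G' ->
  energy L omega (lincomb s t F F') (lincomb s t G G') =
  s ^+ 2 * energy L omega F G + s * t * energy_form L omega F G F' G' + t ^+ 2 * energy L omega F' G'.
Proof.
move=> a a'; rewrite /energy /energy_form /lincomb.
have [l1 l2] := even_H1_L2 (a true); have [l3 l4] := even_H1_L2 (a false).
have [l1' l2'] := even_H1_L2 (a' true); have [l3' l4'] := even_H1_L2 (a' false).
by rewrite !ip_comb //; field.
Qed.

Lemma energy_scale L omega F G s : even_HH1 L F G ->
  energy L omega (fun b x => s * F b x) (fun b x => s * G b x) = s ^+ 2 * energy L omega F G.
Proof.
move=> a; rewrite /energy /energy_form.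
have [l1 l2] := even_H1_L2 (a true); have [l3 l4] := even_H1_L2 (a false).
by rewrite !(ipZl, ipZr) //; try exact: L2perZ; ring.
Qed.

Lemma energy_ge0 L omega F G : 0 <= omega -> 0 <= energy L omega F G.
Proof. by move=> o0; rewrite !(mulr_ge0, addr_ge0) ?ip_ge0. Qed.

(** * The minimization problem for pairs of real functions *)

Definition energy_values L alpha omega tau := [set e | exists F G,
  [/\ even_HH1 L F G, mass L alpha F = tau & e = energy L omega F G]].

Definition parts (u : R -> R[i]) : bool -> R -> R := fun b => if b then re_part u else im_part u.

Definition of_parts F : R -> R[i] := fun x => F true x +i* F false x.

Lemma parts_of_parts F b : parts (of_parts F) b = F b. Proof. by case: b. Qed.

Lemma normc_cmod u x : ComplexField.Normc.normc (u x) = cmod (parts u) x.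
Proof. by rewrite /cmod /hypot /= /re_part /im_part; case: (u x). Qed.

Lemma is_wderiv_wderiv L f : (exists g, is_wderiv L f g) -> is_wderiv L f (wderiv L f).
Proof. by case=> g wg; rewrite /wderiv; apply: (@getPex _ [set g | is_wderiv L f g]); exists g. Qed.

Lemma HH1per_even_parts L u : HH1per_even L u -> even_HH1 L (parts u) (fun b => wderiv L (parts u b)).
Proof.
move=> [[[p1 l1 w1] [p2 l2 w2]] ev]; case; split => //.
- exact: is_wderiv_wderiv.
- by apply: ae_mono ev => x /=; rewrite /re_part => ->.
- exact: is_wderiv_wderiv.
- by apply: ae_mono ev => x /=; rewrite /im_part => ->.
Qed.

Lemma parts_HH1per_even L u G : even_HH1 L (parts u) G -> HH1per_even L u.
Proof.
move=> a; have [p1 l1 w1 e1] := a true; have [p2 l2 w2 e2] := a false; split; [split|].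
- by split => //; exists (G true).
- by split => //; exists (G false).
- apply: ae_mono2 e1 e2 => x /=; rewrite /re_part /im_part.
  by case: (u (- x)) (u x) => [a1 b1] [a2 b2] /= -> ->.
Qed.

(** The chosen weak derivative and [G] agree almost everywhere. *)
Lemma B_energy L omega u G : 0 < L -> even_HH1 L (parts u) G -> B L omega u = energy L omega (parts u) G.
Proof.
move=> L0 a; have a' := HH1per_even_parts (parts_HH1per_even a).
transitivity (energy L omega (parts u) (fun b => wderiv L (parts u b))).
  rewrite /B /energy /energy_form; congr (_ * _).
  have [l1 l2] := even_H1_L2 (a' true); have [l3 l4] := even_H1_L2 (a' false).
  have l11 := L2per_L1perM l1 l1; have l22 := L2per_L1perM l2 l2.
  have l33 := L2per_L1perM l3 l3; have l44 := L2per_L1perM l4 l4.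
  rewrite /ip -[in RHS](RintegralD _ l22 l44) // -[in RHS](RintegralD _ l11 l33) //.
  have lB := L1perD l11 l33; have lA := L1perD l22 l44.
  rewrite -(RintegralZl _ _ lB) // -RintegralD //; last exact: (L1perZ omega lB).
  by apply: eq_Rint => x _; rewrite !normc_cmod /cmod !sqr_hypot /= !expr2.
rewrite /energy /energy_form; congr (_ * (_ + _ + _)).
- have [_ lf w _] := a true; have [_ _ w' _] := a' true.
  have e := wderiv_unique L0 lf w' w.
  by apply: eq_ae_ip => //; [case: w'|case: w|case: w'|case: w].
- have [_ lf w _] := a false; have [_ _ w' _] := a' false.
  have e := wderiv_unique L0 lf w' w.
  by apply: eq_ae_ip => //; [case: w'|case: w|case: w'|case: w].
Qed.

Lemma Y_parts L alpha tau u : Y L alpha tau u <->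
  (exists G, even_HH1 L (parts u) G) /\ mass L alpha (parts u) = tau.
Proof.
have E : (\int[mu]_(x in `[0, L]) (ComplexField.Normc.normc (u x) `^ (alpha + 2)) = mass L alpha (parts u))%R.
  by apply: eq_Rint => x _; rewrite normc_cmod.
split=> [[h1 h2]|[[G a] h2]]; split.
- by exists (fun b => wderiv L (parts u b)); exact: HH1per_even_parts.
- by rewrite -E.
- exact: parts_HH1per_even a.
- by rewrite E.
Qed.

Lemma of_partsK F : parts (of_parts F) = F.
Proof. by apply/funext => b; exact: parts_of_parts. Qed.

Lemma Gamma_inf L alpha tau omega : 0 < L -> Gamma L alpha tau omega = inf (energy_values L alpha omega tau).
Proof.
move=> L0; rewrite /Gamma; congr inf; apply/seteqP; split => e /=.
- move=> [u /Y_parts[[G a] Nu] <-]; exists (parts u), G; split => //.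
  exact: B_energy.
- move=> [F [G [a NF ->]]]; exists (of_parts F).
    by apply/Y_parts; rewrite of_partsK; split => //; exists G.
  by rewrite -[in RHS](of_partsK F); apply: B_energy => //; rewrite of_partsK.
Qed.

End Functionals.

(** * Uniformly convergent subsequences *)

Section Compactness.
Context {R : realType}.
Local Open Scope classical_set_scope.
Implicit Types (L x y M K e : R).

(** An ultrafilter on a compact set converges. *)
Lemma ultra_cvg (U : set_system nat) (f : nat -> R) M : UltraFilter U ->
  (forall n, `|f n| <= M) -> exists l : R, f n @[n --> U] --> l.
Proof.
move=> UU fM.
have FU : ProperFilter (f @ U) by exact: fmap_proper_filter.
have [|p [_ pc]] := @segment_compact R (- M) M (f @ U) FU.
  suff : U (f @^-1` `[- M, M]) by [].
  by apply: filterE => n /=; have := fM n; rewrite ler_norml in_itv.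
exists p => B Bp.
have [//|nB] := in_ultra_setVsetC (f @^-1` B) UU.
have [q [/= nBq Bq]] : (~` B) `&` B !=set0 by apply: pc.
by [].
Qed.

(** Arzela-Ascoli: along an ultrafilter refining [\oo] bounded sequences
    converge at every point, and equicontinuity makes this uniform. *)
Lemma ascoli L M K (V : nat -> bool -> R -> R) : 0 < L -> 0 <= K ->
  (forall n b x, 0 <= x <= L -> `|V n b x| <= M) ->
  (forall n b x y, 0 <= x <= L -> 0 <= y <= L -> (V n b x - V n b y) ^+ 2 <= `|x - y| * K) ->
  exists W : bool -> R -> R,
    (forall b x y, 0 <= x <= L -> 0 <= y <= L -> (W b x - W b y) ^+ 2 <= `|x - y| * K) /\
    forall e m, 0 < e -> exists n, (m <= n)%N /\
      forall b x, 0 <= x <= L -> `|V n b x - W b x| <= e.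
Proof.
move=> L0 K0 VM VK.
have [U [UU oU]] := @ultraFilterLemma nat \oo _.
have PU : ProperFilter U by exact: ultra_proper.
have cv b x : exists l : R, 0 <= x <= L -> V n b x @[n --> U] --> l.
  have [xL|xL] := boolP (0 <= x <= L); last by exists 0.
  by have [l Vl] := ultra_cvg UU (fun n => VM n b x xL); exists l.
pose W b x := sval (cid (cv b x)).
have WP b x : 0 <= x <= L -> V n b x @[n --> U] --> W b x.
  by rewrite /W; case: cid.
have WK b x y : 0 <= x <= L -> 0 <= y <= L -> (W b x - W b y) ^+ 2 <= `|x - y| * K.
  move=> xL yL.
  have H : (V n b x - V n b y) ^+ 2 @[n --> U] --> (W b x - W b y) ^+ 2.
    rewrite expr2; under eq_fun do rewrite expr2.
    by apply: cvgM; apply: cvgB; exact: WP.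
  rewrite -(cvg_lim (@Rhausdorff R) H); apply: limr_le.
    by apply/cvg_ex; eexists; exact: H.
  by apply: filterE => n; exact: VK.
exists W; split => // e m e0.
have e3 : 0 < e / 3 by rewrite divr_gt0.
have osc (f : R -> R) x y N : (0 < N)%N -> L * K / (e / 3) ^+ 2 <= N%:R -> `|x - y| <= L / N%:R ->
    (f x - f y) ^+ 2 <= `|x - y| * K -> `|f x - f y| <= e / 3.
  move=> N0 HN xy fK; rewrite -(@ler_pXn2r _ 2) ?nnegrE //; last exact: ltW.
  rewrite real_normK ?num_real //.
  apply: le_trans fK _; apply: le_trans (ler_wpM2r K0 xy) _.
  rewrite mulrAC ler_pdivrMr ?ltr0n //.
  by rewrite -ler_pdivrMl ?exprn_gt0 // mulrC.
(* a mesh so fine that the functions vary by at most [e / 3] between nodes *)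
pose N := (Num.truncn (L * K / (e / 3) ^+ 2)).+1.
have HN : L * K / (e / 3) ^+ 2 <= N%:R by apply/ltW/truncnS_gt.
pose pt (i : 'I_N.+1) := i%:R * (L / N%:R) : R.
have ptL i : 0 <= pt i <= L.
  have r0 : 0 < L / N%:R by rewrite divr_gt0 // ltr0n.
  apply/andP; split; first by rewrite /pt mulr_ge0 // ltW.
  rewrite -[leRHS](_ : N%:R * (L / N%:R) = L); last by rewrite mulrC divfK // pnatr_eq0.
  by rewrite /pt ler_pM2r // ler_nat -ltnS.
have near_pt : U (fun n => forall i : 'I_N.+1, forall b, `|V n b (pt i) - W b (pt i)| <= e / 3).
  apply: filter_forall => i.
  have H b : U (fun n => `|V n b (pt i) - W b (pt i)| <= e / 3).
    have /cvgrPdist_le/(_ _ e3) := WP b _ (ptL i).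
    by apply: filterS => n; rewrite distrC.
  by apply: filterS2 (H true) (H false) => n h1 h2 [].
have mU : U (fun n => (m <= n)%N) by apply: oU; exists m.
have [n [mn Hn]] := filter_ex (filterI mU near_pt).
exists n; split => // b x xL.
have /andP[x0 xL'] := xL.
have y0 : 0 <= x * N%:R / L by rewrite divr_ge0 ?mulr_ge0 // ltW.
have /andP[h1] := truncn_itv y0; rewrite -natr1 => h2.
have kN : (Num.truncn (x * N%:R / L) < N.+1)%N.
  rewrite ltnS -(ler_nat R); apply: (le_trans h1).
  by rewrite ler_pdivrMr // mulrC ler_pM2l ?ltr0n.
pose i : 'I_N.+1 := Ordinal kN.
have xi : `|x - pt i| <= L / N%:R.
  have r0 : 0 < L / N%:R by rewrite divr_gt0 // ltr0n.
  have -> : x - pt i = (x * N%:R / L - (Num.truncn (x * N%:R / L))%:R) * (L / N%:R).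
    rewrite /pt /i /= mulrBl; congr (_ - _).
    by rewrite mulrA divfK ?gt_eqF // mulfK // pnatr_eq0.
  rewrite normrM (gtr0_norm r0) ger_pMl // ler_norml.
  by move: h1 h2; move: (x * N%:R / L) (_%:R) => u v; lra.
have a1 := osc _ _ _ N isT HN xi (VK n b _ _ xL (ptL i)).
have a2 := osc _ _ _ N isT HN xi (WK b _ _ xL (ptL i)).
have a3 := Hn i b.
by move: a1 a2 a3; rewrite !ler_norml; lra.
Qed.

End Compactness.

(** * The infimum and its homogeneity *)

Section Existence.
Context {R : realType}.
Local Open Scope classical_set_scope.
Notation mu := (@lebesgue_measure R).
Implicit Types (L x y M e alpha omega tau : R) (F G : bool -> R -> R).

Lemma even_H1_cst L c : 0 < L -> even_H1 L (fun=> c) (fun=> 0).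
Proof.
move=> L0; split.
- by [].
- exact: L2per_cst.
- have := is_wderiv_C1 L0 (test_cst L c).
  have -> // : derive1 (fun=> c : R) = (fun=> 0) :> (R -> R).
  by apply: is_derive_derive1 => x; exact: is_derive_cst.
- exact: aeW.
Qed.

(** A constant of the right modulus. *)
Lemma energy_values_nonempty L alpha omega tau : 0 < L -> 0 < alpha -> 0 < tau ->
  energy_values L alpha omega tau !=set0.
Proof.
move=> L0 al0 t0; have pn0 : alpha + 2 != 0 by rewrite gt_eqF //; lra.
pose c := (tau / L) `^ (alpha + 2)^-1.
pose F (b : bool) := (fun=> if b then c else 0) : R -> R.
exists (energy L omega F (fun _ _ => 0)), F, (fun _ _ => 0); split => //.
  by case; exact: even_H1_cst.
rewrite /mass /cmod /hypot /= expr0n addr0 sqrtr_sqr Rint_cst //.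
rewrite ger0_norm ?powR_ge0 // -powRrM mulVf // powRr1 ?divr_ge0 ?ltW //.
by rewrite divfK // gt_eqF.
Qed.

Lemma energy_values_lb L alpha omega tau : 0 <= omega -> lbound (energy_values L alpha omega tau) 0.
Proof. by move=> o0 _ [F [G [_ _ ->]]]; exact: energy_ge0. Qed.

(** The number [Gamma], see [Gamma_inf]. *)
Definition min_energy L alpha omega tau := inf (energy_values L alpha omega tau).

Lemma min_energy_le L alpha omega tau F G : 0 <= omega -> even_HH1 L F G -> mass L alpha F = tau ->
  min_energy L alpha omega tau <= energy L omega F G.
Proof.
move=> o0 a NF; apply: ge_inf; first by exists 0; exact: energy_values_lb.
by exists F, G.
Qed.

Lemma min_energy_ge0 L alpha omega tau : 0 < L -> 0 < alpha -> 0 <= omega -> 0 < tau ->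
  0 <= min_energy L alpha omega tau.
Proof. by move=> *; apply: lb_le_inf; [exact: energy_values_nonempty|exact: energy_values_lb]. Qed.

Lemma min_energy_approx L alpha omega tau e : 0 < L -> 0 < alpha -> 0 <= omega -> 0 < tau -> 0 < e ->
  exists F G, [/\ even_HH1 L F G, mass L alpha F = tau & energy L omega F G < min_energy L alpha omega tau + e].
Proof.
move=> L0 al0 o0 t0 e0.
have hi : has_inf (energy_values L alpha omega tau).
  split; first exact: energy_values_nonempty.
  by exists 0; exact: energy_values_lb.
have [_ [F [G [a NF ->]]] H] := inf_adherent e0 hi.
by exists F, G.
Qed.

(** Homogeneity turns the minimization under a constraint into an inequality
    for all functions. *)
Lemma min_energy_homog L alpha omega tau q F G : 0 < L -> 0 < alpha -> 0 <= omega -> 0 < tau ->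
  0 < q -> even_HH1 L F G -> q `^ (alpha + 2) * tau <= mass L alpha F ->
  q ^+ 2 * min_energy L alpha omega tau <= energy L omega F G.
Proof.
move=> L0 al0 o0 t0 q0 a H; set p := alpha + 2 in H *.
have p0 : 0 < p by rewrite /p; lra.
have pn0 : p != 0 by rewrite gt_eqF.
have N0 : 0 < mass L alpha F by apply: lt_le_trans H; rewrite mulr_gt0 ?powR_gt0.
pose s := (tau / mass L alpha F) `^ p^-1.
have s0 : 0 <= s by exact: powR_ge0.
have sp : s `^ p = tau / mass L alpha F.
  by rewrite -powRrM mulVf // powRr1 // divr_ge0 // ltW.
have Ns : mass L alpha (fun b x => s * F b x) = tau.
  by rewrite mass_scale //; [rewrite sp divfK // gt_eqF|exact: L1per_mass a].
have := min_energy_le o0 (even_HH1_scale s a) Ns; rewrite energy_scale // => G1.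
have qs : q * s <= 1.
  rewrite leNgt; apply/negP => qs1.
  have : 1 < (q * s) `^ p.
    have := @gt0_ltr_powR R p p0 1 (q * s); rewrite powR1; apply => //.
      by rewrite nnegrE.
    by rewrite nnegrE mulr_ge0 // ltW.
  rewrite powRM // ?ltW // sp mulrA ltr_pdivlMr // mul1r.
  by rewrite ltNge H.
apply: le_trans (ler_wpM2l (sqr_ge0 q) G1) _.
rewrite mulrA -exprMn ler_piMl ?energy_ge0 //.
by rewrite exprn_ile1 // mulr_ge0 // ltW.
Qed.

(** By the parallelogram identity: the midpoint of two near-minimizers that are
    uniformly close nearly satisfies the constraint, so its energy is not much
    below the infimum and the energy of the difference is small. *)
Lemma near_minimizers_close L alpha omega tau M d : 0 < L -> 0 < alpha -> 0 <= omega -> 0 < tau ->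
  0 <= M -> 0 < d ->
  exists2 e, 0 < e & forall F G F' G', even_HH1 L F G -> even_HH1 L F' G' ->
    mass L alpha F = tau -> energy L omega F G <= min_energy L alpha omega tau + e ->
    energy L omega F' G' <= min_energy L alpha omega tau + e ->
    bounded2 L F M -> bounded2 L F' M -> bounded2 L (lincomb 1 (-1) F' F) (2 * e) ->
    forall b, ip L (fun x => G' b x - G b x) (fun x => G' b x - G b x) <= d.
Proof.
move=> L0 al0 o0 t0 M0 d0; set p := alpha + 2; set g := min_energy L alpha omega tau.
have p0 : 0 < p by rewrite /p; lra.
have g0 : 0 <= g by exact: min_energy_ge0.
have [eta [eta0 eta2 etad]] : exists eta, [/\ 0 < eta, eta <= 2^-1 & eta * g <= d / 16].
  exists (Num.min 2^-1 (d / (16 * (g + 1)))); split.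
  - by rewrite lt_min; apply/andP; split; [|rewrite divr_gt0 // mulr_gt0 //]; lra.
  - by rewrite ge_min lexx.
  - apply: le_trans (_ : d / (16 * (g + 1)) * g <= _).
      by rewrite ler_wpM2r // ge_min lexx orbT.
    rewrite mulrAC ler_pdivrMr; last by rewrite mulr_gt0 //; lra.
    rewrite (_ : d / 16 * (16 * (g + 1)) = d * (g + 1)); last by field.
    by rewrite ler_pM2l //; lra.
(* a midpoint of mass at least [q `^ p * tau] has energy at least
   [(1 - eta) * g] *)
have [q [q0 q2 qp]] : exists q, [/\ 0 < q, q ^+ 2 = 1 - eta & q `^ p < 1].
  have q2 : Num.sqrt (1 - eta) ^+ 2 = 1 - eta by rewrite sqr_sqrtr //; lra.
  have q0 : 0 < Num.sqrt (1 - eta) by rewrite sqrtr_gt0; lra.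
  exists (Num.sqrt (1 - eta)); split => //.
  have := @gt0_ltr_powR R p p0 (Num.sqrt (1 - eta)) 1; rewrite powR1; apply => //.
  - by rewrite nnegrE ltW.
  - by rewrite nnegrE.
  - by rewrite -(@ltr_pXn2r _ 2) ?nnegrE // ?ltW // q2 expr1n; lra.
(* [K] is the Lipschitz constant of the mass given by [mass_close] *)
pose K := p * ((2 * M) `^ alpha * (2 * M * 1)) * L.
have K0 : 0 <= K by rewrite !mulr_ge0 ?powR_ge0 // ltW.
have [e [e0 ed eK]] : exists e, [/\ 0 < e, e <= d / 16 & K * e <= (1 - q `^ p) * tau].
  have c0 : 0 < (1 - q `^ p) * tau by rewrite mulr_gt0 // subr_gt0.
  exists (Num.min (d / 16) ((1 - q `^ p) * tau / (K + 1))); split.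
  - by rewrite lt_min divr_gt0 //= divr_gt0 //; lra.
  - by rewrite ge_min lexx.
  - apply: le_trans (_ : K * ((1 - q `^ p) * tau / (K + 1)) <= _).
      by rewrite ler_wpM2l // ge_min lexx orbT.
    rewrite mulrA ler_pdivrMr; last lra.
    by rewrite mulrC ler_wpM2l //; [exact: ltW|lra].
exists e => // F G F' G' a a' NF E1 E2 bF bF' bd b.
have am := even_HH1_lin 2^-1 2^-1 a a'.
have ad := even_HH1_lin (- 2^-1) 2^-1 a a'.
have Nm : q `^ p * tau <= mass L alpha (lincomb 2^-1 2^-1 F F').
  have bm : bounded2 L (lincomb 2^-1 2^-1 F F') M.
    move=> c; apply: ae_on_mono2 (bF c) (bF' c) => x _; rewrite /lincomb !ler_norml.
    by move: (F c x) (F' c x) => u v; clear; lra.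
  have bmd : bounded2 L (lincomb 1 (-1) (lincomb 2^-1 2^-1 F F') F) e.
    move=> c; apply: ae_on_mono (bd c) => x _; rewrite /lincomb !ler_norml.
    by move: (F c x) (F' c x) => u v; clear; lra.
  have := mass_close L0 al0 (even_HH1_measurable a) (even_HH1_measurable am) bF bm bmd.
  rewrite NF -/p => H.
  have KE : p * ((2 * M) `^ alpha * (2 * M * e)) * L = K * e by rewrite /K; ring.
  by move: H eK; rewrite KE mulrBl mul1r; move: (K * e) (_ * tau) (mass _ _ _) => u v w; clear; lra.
have Em := min_energy_homog L0 al0 o0 t0 q0 am Nm.
have par : energy L omega (lincomb 2^-1 2^-1 F F') (lincomb 2^-1 2^-1 G G') +
    energy L omega (lincomb (- 2^-1) 2^-1 F F') (lincomb (- 2^-1) 2^-1 G G') =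
    2^-1 * (energy L omega F G + energy L omega F' G').
  by rewrite !energy_lin //; field.
have Ed : energy L omega (lincomb (- 2^-1) 2^-1 F F') (lincomb (- 2^-1) 2^-1 G G') <= d / 8.
  have : (1 - eta) * g <= energy L omega (lincomb 2^-1 2^-1 F F') (lincomb 2^-1 2^-1 G G') by rewrite -q2.
  rewrite mulrBl mul1r; move: par E1 E2 etad ed; rewrite -/g.
  move: (energy _ _ _ _) (energy _ _ _ _) (energy _ _ _ _) (energy _ _ _ _) (eta * g).
  by clear => E1 E2 E3 E4 u; lra.
have ipd c : ip L (lincomb (- 2^-1) 2^-1 G G' c) (lincomb (- 2^-1) 2^-1 G G' c) =
    4^-1 * ip L (fun x => G' c x - G c x) (fun x => G' c x - G c x).
  have [_ l1] := even_H1_L2 (a c); have [_ l2] := even_H1_L2 (a' c).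
  have ld := L2perB l2 l1.
  rewrite (_ : 4^-1 = 2^-1 * 2^-1); last by field.
  rewrite -mulrA -ipZr // -ipZl //; last exact: L2perZ.
  by apply: eq_Rint => x _; rewrite /lincomb; ring.
have : 2^-1 * (ip L (lincomb (- 2^-1) 2^-1 G G' true) (lincomb (- 2^-1) 2^-1 G G' true) +
    ip L (lincomb (- 2^-1) 2^-1 G G' false) (lincomb (- 2^-1) 2^-1 G G' false)) <= d / 8.
  apply: le_trans Ed; rewrite /energy /energy_form ler_wpM2l // lerDl.
  by rewrite mulr_ge0 // addr_ge0 // ip_ge0.
rewrite !ipd.
have := ip_ge0 L (fun x => G' true x - G true x).
have := ip_ge0 L (fun x => G' false x - G false x).
by case: b; move: (ip _ _ _) (ip _ _ _) => u v; clear; lra.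
Qed.

End Existence.

(** * Existence of a minimizer *)

Section Minimizer.
Context {R : realType}.
Local Open Scope classical_set_scope.
Notation mu := (@lebesgue_measure R).
Implicit Types (L x y M e alpha omega tau : R) (F G : bool -> R -> R).

Lemma hoelder_within_continuous L (W : R -> R) (K : R) : 0 <= K ->
  (forall x y, 0 <= x <= L -> 0 <= y <= L -> (W x - W y) ^+ 2 <= `|x - y| * K) ->
  {within `[0, L], continuous W}.
Proof.
move=> K0 WK; apply/subspace_continuousP => x xL; apply/cvgrPdist_le => e e0.
rewrite near_withinE; apply/nbhs_ballP.
have d0 : 0 < e ^+ 2 / (K + 1) by rewrite divr_gt0 ?exprn_gt0 //; lra.
exists (e ^+ 2 / (K + 1)) => // y xy yL.
rewrite -(@ler_pXn2r _ 2) ?nnegrE //; last exact: ltW.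
rewrite real_normK ?num_real //.
have H : (W x - W y) ^+ 2 <= `|x - y| * K.
  by apply: WK; [move: xL; rewrite /= in_itv|move: yL; rewrite /= in_itv].
apply: le_trans H _.
have xy' : `|x - y| < e ^+ 2 / (K + 1) by exact: xy.
apply: le_trans (ler_wpM2r K0 (ltW xy')) _.
rewrite mulrAC ler_pdivrMr; last lra.
by rewrite ler_wpM2l ?sqr_ge0 //; lra.
Qed.

Lemma le0_of_cvg0 (u : nat -> R) (x C : R) : u n @[n --> \oo] --> (0 : R) ->
  (forall n, x <= C * u n) -> x <= 0.
Proof.
move=> u0 xu; have H : C * u n @[n --> \oo] --> (C * 0 : R) by apply: cvgM => //; exact: cvg_cst.
rewrite mulr0 in H; rewrite -(cvg_lim (@Rhausdorff R) H); apply: limr_ge.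
  by apply/cvg_ex; exists 0.
exact: nearW.
Qed.

(** A decreasing positive sequence below [e] and below a geometric sequence. *)
Fixpoint runmin (e : nat -> R) k : R :=
  if k is k'.+1 then Num.min (runmin e k' / 2) (e k) else Num.min 1 (e 0%N).

Lemma runmin_gt0 (e : nat -> R) k : (forall k, 0 < e k) -> 0 < runmin e k.
Proof.
by move=> e0; elim: k => [|k IH] /=; rewrite lt_min e0 ?ltr01 // divr_gt0.
Qed.

Lemma runmin_le (e : nat -> R) k : runmin e k <= e k.
Proof. by case: k => [|k] /=; rewrite ge_min lexx orbT. Qed.

Lemma runmin_dec (e : nat -> R) k : (forall k, 0 < e k) -> runmin e k.+1 <= runmin e k.
Proof.
move=> e0; have := runmin_gt0 k e0; rewrite /= ge_min => h.
by apply/orP; left; lra.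
Qed.

Lemma runmin_geom (e : nat -> R) k : runmin e k <= 2^-1 ^+ k.
Proof.
elim: k => [|k IH] /=; first by rewrite expr0 ge_min lexx.
by rewrite ge_min exprS mulrC ler_wpM2l ?invr_ge0.
Qed.

Lemma runmin_cvg (e : nat -> R) : (forall k, 0 < e k) -> runmin e k @[k --> \oo] --> (0 : R).
Proof.
move=> e0; apply: (@squeeze_cvgr _ _ _ _ (cst 0) (fun k => 2^-1 ^+ k)).
- by near=> n; rewrite runmin_geom /= andbT ltW // runmin_gt0.
- exact: cvg_cst.
- by apply: cvg_expr; rewrite ger0_norm ?invr_ge0 // invf_lt1 // ltr1n.
Unshelve. all: by end_near. Qed.

Lemma energy_ip_le L omega F G b : 0 < omega ->
  ip L (G b) (G b) <= 2 * energy L omega F G /\ ip L (F b) (F b) <= 2 / omega * energy L omega F G.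
Proof.
move=> o0; rewrite /energy /energy_form.
have g1 := ip_ge0 L (G true); have g2 := ip_ge0 L (G false).
have f1 := ip_ge0 L (F true); have f2 := ip_ge0 L (F false).
split.
  have : 0 <= omega * (ip L (F true) (F true) + ip L (F false) (F false)).
    by rewrite mulr_ge0 ?addr_ge0 // ltW.
  by case: b; move: g1 g2; move: (ip _ _ _) (ip _ _ _) (omega * _) => u v w; lra.
rewrite mulrA (_ : 2 / omega * 2^-1 = omega^-1); last by field; rewrite gt_eqF.
rewrite -ler_pdivrMl ?invr_gt0 // invrK.
have : 0 <= omega * ip L (F true) (F true) by rewrite mulr_ge0 // ltW.
have : 0 <= omega * ip L (F false) (F false) by rewrite mulr_ge0 // ltW.
rewrite mulrDr; case: b; move: g1 g2; move: (ip _ (G _) _) (ip _ (G _) _) => u v.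
all: by move: (omega * _) (omega * _) => w z; lra.
Qed.

(** A minimizing sequence has a uniformly convergent subsequence; by
    [near_minimizers_close] it then converges strongly in [H^1]. *)
Theorem exists_minimizer L alpha omega tau :
  0 < L -> 0 < alpha -> 0 < omega -> 0 < tau ->
  exists F G, [/\ even_HH1 L F G, mass L alpha F = tau & energy L omega F G = min_energy L alpha omega tau].
Proof.
move=> L0 al0 o0 t0; set g := min_energy L alpha omega tau.
have g0 : 0 <= g by apply: min_energy_ge0 => //; exact: ltW.
have /choice[S SP] : forall n, exists P : (bool -> R -> R) * (bool -> R -> R),
    [/\ even_HH1 L P.1 P.2, mass L alpha P.1 = tau & energy L omega P.1 P.2 < g + n.+1%:R^-1].
  move=> n.
  have n0 : 0 < n.+1%:R^-1 :> R by rewrite invr_gt0.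
  by have [F [G H]] := min_energy_approx L0 al0 (ltW o0) t0 n0; exists (F, G).
have aS n : even_HH1 L (S n).1 (S n).2 by case: (SP n).
have ES n : energy L omega (S n).1 (S n).2 <= g + 1.
  have [_ _ /ltW H] := SP n; apply: (le_trans H); rewrite lerD2l invf_le1 //.
  by rewrite ler1n.
have /choice[C CP] : forall nb : nat * bool, exists c, ae_on L (fun x => (S nb.1).1 nb.2 x = c + prim ((S nb.1).2 nb.2) x).
  move=> [n b].
  by have [_ l w _] := aS n b; exact: wderiv_rep.
pose V n b x := C (n, b) + prim ((S n).2 b) x.
have lS n b : L2per L ((S n).1 b) /\ L2per L ((S n).2 b) by exact: even_H1_L2 (aS n b).
pose K := 2 * (g + 1).
have K0 : 0 <= K by rewrite mulr_ge0 //; lra.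
pose M := Num.sqrt (2 / L * (2 / omega * (g + 1)) + 2 * L * K).
have M0 : 0 <= M by exact: sqrtr_ge0.
have ipG n b : ip L ((S n).2 b) ((S n).2 b) <= K.
  have [H _] := energy_ip_le L (S n).1 (S n).2 b o0; apply: le_trans H _.
  by rewrite ler_wpM2l // ES.
have VM n b x : 0 <= x <= L -> `|V n b x| <= M.
  move=> xL; rewrite /M -sqrtr_sqr ler_wsqrtr //.
  apply: le_trans (sup_bound L0 (lS n b).1 (lS n b).2 (CP (n, b)) xL) _.
  apply: lerD; last by rewrite ler_wpM2l // mulr_ge0 // ltW.
  apply: ler_wpM2l; first by rewrite divr_ge0 // ltW.
  have [_ H] := energy_ip_le L (S n).1 (S n).2 b o0; apply: le_trans H _.
  by rewrite ler_wpM2l ?ES // divr_ge0 // ltW.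
have VK n b x y : 0 <= x <= L -> 0 <= y <= L -> (V n b x - V n b y) ^+ 2 <= `|x - y| * K.
  move=> xL yL; rewrite /V opprD addrACA subrr add0r.
  apply: le_trans (prim_hoelder xL yL (lS n b).2) _.
  by rewrite ler_wpM2l.
have [W [WK WU]] := ascoli L0 K0 VM VK.
have I0 : 0 <= (0 : R) <= L by rewrite lexx ltW.
have IL : 0 <= L <= L by rewrite lexx ltW.
(* pointwise identities shared by all the [V n] pass to the limit *)
have transfer b x y : 0 <= x <= L -> 0 <= y <= L -> (forall n, V n b x = V n b y) -> W b x = W b y.
  move=> xL yL H; apply/eqP; rewrite -subr_eq0 -normr_le0; apply/ler_addgt0Pr => e e0; rewrite add0r.
  have e2 : 0 < e / 2 by rewrite divr_gt0.
  have [n [_ Hn]] := WU _ 0%N e2.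
  have := Hn b _ xL; have := Hn b _ yL; rewrite (H n) !ler_norml.
  by move: (V n b y) (W b x) (W b y) => u v w; lra.
have WL b : W b L = W b 0.
  apply: transfer => // n; rewrite /V prim0; congr (_ + _).
  by have [_ _ w _] := aS n b; exact: wderiv_int0 w.
have Wev b x : 0 <= x <= L -> W b (L - x) = W b x.
  move=> xL; apply: transfer => //; first by move: xL; lra.
  move=> n; have [p _ _ ev] := aS n b.
  exact: (rep_even L0 p (lS n b).2 ev (CP (n, b)) xL).
have WM b x : 0 <= x <= L -> `|W b x| <= M.
  move=> xL; apply/ler_addgt0Pr => e e0.
  have [n [_ Hn]] := WU _ 0%N e0.
  have := Hn b _ xL; have := VM n b _ xL; rewrite !ler_norml.
  by move: (V n b x) (W b x) => u v; lra.
have Wc b : {within `[0, L], continuous (W b)} by apply: hoelder_within_continuous K0 (WK b).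
pose Fi b := periodize L (W b).
have cFi b : continuous (Fi b) by apply: periodize_continuous => //; exact: WL.
have FiE b x : 0 <= x <= L -> Fi b x = W b x by move=> xL; apply: periodizeE => //; exact: WL.
have lFi b : L2per L (Fi b) by exact: continuous_L2per.
(* the tolerances [e k] make the derivatives Cauchy at the geometric rate that
   [L2_complete] asks for *)
have /choice[e eP] : forall k, exists ek, 0 < ek /\ forall F G F' G', even_HH1 L F G -> even_HH1 L F' G' ->
    mass L alpha F = tau -> energy L omega F G <= g + ek -> energy L omega F' G' <= g + ek ->
    bounded2 L F M -> bounded2 L F' M -> bounded2 L (lincomb 1 (-1) F' F) (2 * ek) ->
    forall b, ip L (fun x => G' b x - G b x) (fun x => G' b x - G b x) <= (4 ^+ k * (2 ^ k.+1)%:R)^-1.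
  move=> k.
  have d0 : 0 < (4 ^+ k * (2 ^ k.+1)%:R)^-1 :> R.
    by rewrite invr_gt0 mulr_gt0 ?exprn_gt0 // ltr0n expn_gt0.
  by have [ek ek0 H] := near_minimizers_close L0 al0 (ltW o0) t0 M0 d0; exists ek.
have e0 k : 0 < e k by case: (eP k).
pose r := runmin e.
have r0 k : 0 < r k by exact: runmin_gt0.
have /choice[n nP] : forall k, exists m, m.+1%:R^-1 <= r k /\
    forall b x, 0 <= x <= L -> `|V m b x - W b x| <= r k.
  move=> k.
  have [m [km Hm]] := WU (r k) (Num.truncn (r k)^-1) (r0 k).
  exists m; split => //.
  rewrite -[leRHS]invrK lef_pV2 ?posrE ?invr_gt0 ?ltr0n //.
  by apply: ltW; apply: lt_le_trans (truncnS_gt _) _; rewrite ler_nat ltnS.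
pose f k := (S (n k)).1; pose h k := (S (n k)).2.
have af k : even_HH1 L (f k) (h k) by exact: aS.
have Nf k : mass L alpha (f k) = tau by case: (SP (n k)).
have Ef k : energy L omega (f k) (h k) <= g + r k.
  have [_ _ /ltW H] := SP (n k); apply: le_trans H _; rewrite lerD2l; exact: (nP k).1.
have fFi k b : ae_on L (fun x => `|f k b x - Fi b x| <= r k).
  apply: ae_on_mono (CP (n k, b)) => x xL /= fE; rewrite /f fE FiE //.
  exact: ((nP k).2 b x xL).
have bf k : bounded2 L (f k) M.
  by move=> b; apply: ae_on_mono (CP (n k, b)) => x xL /= fE; rewrite /f fE; exact: VM.
have bFi : bounded2 L Fi M by move=> b; apply: ae_on_all => x xL; rewrite FiE // WM.
have inc b k : 4 ^+ k * ip L (fun x => h k.+1 b x - h k b x) (fun x => h k.+1 b x - h k b x)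
    <= 1 / (2 ^ k.+1)%:R.
  have [_ H] := eP k.
  have rek : r k <= e k by exact: runmin_le.
  have rk1 : r k.+1 <= r k by exact: runmin_dec.
  have := H (f k) (h k) (f k.+1) (h k.+1) (af k) (af k.+1) (Nf k).
  move=> /(_ _ _ (bf k) (bf k.+1) _ b) H2.
  rewrite div1r -ler_pdivlMl ?exprn_gt0 // -invfM; apply: H2.
  - by apply: le_trans (Ef k) _; rewrite lerD2l.
  - by apply: le_trans (Ef k.+1) _; rewrite lerD2l; exact: le_trans rek.
  - move=> c; apply: ae_on_mono2 (fFi k c) (fFi k.+1 c) => x _; rewrite /lincomb !ler_norml.
    by move: (f k c x) (f k.+1 c x) (Fi c x) rek rk1 => u v w; lra.
have /choice[Gi GiP] : forall b, exists gi, L2per L gi /\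
    ip L (fun x => gi x - h k b x) (fun x => gi x - h k b x) @[k --> \oo] --> (0 : R).
  move=> b.
  apply: (@L2_complete _ L (fun k => h k b)) => k; last exact: inc.
  by have [] := even_H1_L2 (af k b).
have lf k b : L2per L (f k b) by have [] := even_H1_L2 (af k b).
have lh k b : L2per L (h k b) by have [] := even_H1_L2 (af k b).
have fcvg b : ip L (fun x => Fi b x - f k b x) (fun x => Fi b x - f k b x) @[k --> \oo] --> (0 : R).
  apply: (@squeeze_cvgr _ _ _ _ (cst 0) (fun k => r k * r k * L)).
  - near=> k; rewrite ip_ge0 /= -Rint_cst //; apply: le_ae_Rint.
    + by apply: L2per_L1perM; exact: L2perB.
    + exact: L1per_cst.
    + apply: ae_on_mono (fFi k b) => x _; rewrite distrC => H.
      by rewrite -expr2 -real_normK ?num_real // expr2 ler_pM.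
  - exact: cvg_cst.
  - have rc : r k @[k --> \oo] --> (0 : R) by exact: runmin_cvg.
    suff : r k * r k * L @[k --> \oo] --> 0 * 0 * L by rewrite mulr0 mul0r.
    by apply: cvgM; [apply: cvgM|exact: cvg_cst].
have aFi : even_HH1 L Fi Gi.
  move=> b; split.
  - exact: periodize_periodic.
  - by [].
  - apply: (@is_wderiv_lim _ L (fun k => f k b) (fun k => h k b)) => //.
    + by case: (GiP b).
    + by move=> k; have [_ _ ] := af k b.
    + by case: (GiP b).
  - by apply: aeW => x; apply: periodize_even; [|exact: WL|exact: Wev].
have rc : r k @[k --> \oo] --> (0 : R) by exact: runmin_cvg.
have NFi : mass L alpha Fi = tau.
  have mFi := even_HH1_measurable aFi.
  pose Q := (alpha + 2) * ((2 * M) `^ alpha * (2 * M)) * L.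
  have QE k : (alpha + 2) * ((2 * M) `^ alpha * (2 * M * r k)) * L = Q * r k by rewrite /Q; ring.
  apply/eqP; rewrite eq_le -subr_le0 -[X in _ && X]subr_le0; apply/andP; split.
  - apply: (le0_of_cvg0 (C := Q) rc) => k; rewrite -QE -(Nf k).
    apply: mass_close => //; [exact: even_HH1_measurable (af k)|].
    move=> b; apply: ae_on_mono (fFi k b) => x _.
    by rewrite /lincomb mul1r mulN1r.
  - apply: (le0_of_cvg0 (C := Q) rc) => k; rewrite -QE -{1}(Nf k).
    apply: mass_close => //; [exact: even_HH1_measurable (af k)|].
    move=> b; apply: ae_on_mono (fFi k b) => x _.
    by rewrite /lincomb mul1r mulN1r distrC.
exists Fi, Gi; split => //.
apply/eqP; rewrite eq_le; apply/andP; split; last by apply: min_energy_le => //; exact: ltW.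
have Ecvg : energy L omega (f k) (h k) @[k --> \oo] --> energy L omega Fi Gi.
  apply: cvgM; first exact: cvg_cst.
  apply: cvgD.
    by apply: cvgD; apply: ip_cvg => //; [case: (GiP true)..|case: (GiP false)|case: (GiP false)].
  apply: cvgM; first exact: cvg_cst.
  by apply: cvgD; apply: ip_cvg.
have Ecvg2 : g + r k @[k --> \oo] --> g.
  by rewrite -[X in _ --> X]addr0; apply: cvgD => //; exact: cvg_cst.
by apply: (ler_cvg_to Ecvg Ecvg2); near=> k.
Unshelve. all: by end_near. Qed.

End Minimizer.

(** * The weak Euler-Lagrange equation *)

Section EulerLagrange.
Context {R : realType}.
Local Open Scope classical_set_scope.
Notation mu := (@lebesgue_measure R).
Implicit Types (L x y M e t alpha omega tau : R) (F G : bool -> R -> R).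

(** The quadratic in [t] touches the power from above at [t = 0], so the two
    have the same slope there. *)
Lemma power_slope (g b e2 c r : R) :
  (forall t, 0 < 1 + t * c -> g * (1 + t * c) `^ r <= g + t * b + t ^+ 2 * e2) ->
  b = g * (r * c).
Proof.
move=> H.
pose f t := g + t * b + t ^+ 2 * e2 - g * (1 + t * c) `^ r.
pose d := (`|c| + 1)^-1.
have c1 : 0 < `|c| + 1 by rewrite ltr_wpDl.
have d0 : 0 < d by rewrite invr_gt0.
have pos t : t \in (`](- d), d[)%R -> 0 < 1 + t * c.
  rewrite in_itv /= -ltr_norml => td.
  have : `|t * c| < 1.
    rewrite normrM; apply: le_lt_trans (_ : `|t| * (`|c| + 1) < 1).
      by rewrite ler_wpM2l // lerDl.
    by rewrite -ltr_pdivlMr // div1r.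
  by rewrite ltr_norml; lra.
have df t : t \in (`](- d), d[)%R ->
    is_derive t 1 f (b + 2 * t * e2 - g * (r * (1 + t * c) `^ (r - 1) * c)).
  move=> /pos tp.
  have d1 : is_derive t 1 (fun t => (1 + t * c) `^ r) (r * (1 + t * c) `^ (r - 1) * c).
    apply: (@is_derive1_comp _ (fun y : R => y `^ r) (fun t : R => 1 + t * c)).
      exact: is_derive1_powR.
    by apply: is_derive_eq; rewrite /GRing.scale /=; ring.
  by apply: is_derive_eq; rewrite /GRing.scale /=; ring.
have i0 : (0:R) \in (`](- d), d[)%R by rewrite in_itv /= oppr_lt0 d0.
have := @derive1_at_min R f (- d) d 0.
move=> /(_ _ _ i0) -[]; first by lra.
- by move=> t /df[].
- move=> t td; rewrite /f !mul0r expr0n /= mul0r !addr0 powR1 mulr1 subrr subr_ge0.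
  by apply: H; exact: pos.
- move=> _ D0; have [_] := df 0 i0.
  rewrite D0 mulr0 mul0r !addr0 mul0r addr0 powR1 mulr1 => /eqP.
  by rewrite eq_sym subr_eq0 => /eqP.
Qed.

(** Along [F + t F'] the mass is at least its first-order expansion, so
    homogeneity bounds the energy, a quadratic in [t], from below by a power of
    an affine function of [t], with equality at [t = 0]; equate the slopes. *)
Lemma minimizer_variation L alpha omega tau F G F' G' : 0 < L -> 0 < alpha -> 0 < omega -> 0 < tau ->
  even_HH1 L F G -> mass L alpha F = tau -> energy L omega F G = min_energy L alpha omega tau ->
  even_HH1 L F' G' ->
  energy_form L omega F G F' G' = 2 * min_energy L alpha omega tau / tau * mass_form L alpha F F'.
Proof.
move=> L0 al0 o0 t0 a NF EF a'; set g := min_energy L alpha omega tau in EF *.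
set p := alpha + 2; have p0 : 0 < p by rewrite /p; lra.
have pn0 : p != 0 by rewrite gt_eqF.
have tn0 : tau != 0 by rewrite gt_eqF.
have [M bF] := even_HH1_bounded L0 a; have [M' bF'] := even_HH1_bounded L0 a'.
rewrite (@power_slope g (energy_form L omega F G F' G') (energy L omega F' G')
  (p * mass_form L alpha F F' / tau) (2 / p)); first by field; apply/andP; split.
move=> t tp; set c := p * mass_form L alpha F F' / tau in tp *.
(* [q `^ p * tau] is the first-order expansion of the mass along [F'] *)
pose q := (1 + t * c) `^ p^-1.
have q0 : 0 < q by rewrite powR_gt0.
have q2 : q ^+ 2 = (1 + t * c) `^ (2 / p).
  by rewrite -(powR_mulrn 2 (ltW q0)) /q -powRrM; congr (_ `^ _); rewrite mulrC.
have qp : q `^ p = 1 + t * c by rewrite -powRrM mulVf // powRr1 // ltW.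
have NFt : q `^ p * tau <= mass L alpha (lincomb 1 t F F').
  have := mass_tangent t al0 (even_HH1_measurable a) (even_HH1_measurable a') bF bF'.
  apply: le_trans; rewrite qp NF -/p le_eqVlt; apply/orP; left; apply/eqP.
  by rewrite /c; field.
have := min_energy_homog L0 al0 (ltW o0) t0 q0 (even_HH1_lin 1 t a a') NFt.
by rewrite energy_lin // q2 EF -/g expr1n !mul1r mulrC.
Qed.

(** The second derivative prescribed by the equation with multiplier [kappa]. *)
Definition rhs alpha omega kappa F (b : bool) x := omega * F b x - kappa * (cmod F x `^ alpha * F b x).

Lemma rhs_L2 L alpha omega kappa F G : 0 < L -> 0 < alpha -> even_HH1 L F G ->
  forall b, L2per L (rhs alpha omega kappa F b).
Proof.
move=> L0 al0 a b; have [M bF] := even_HH1_bounded L0 a; have mF := even_HH1_measurable a.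
apply: L2perB; apply: L2perZ; first by have [] := even_H1_L2 (a b).
apply: (@L2per_bounded _ _ _ ((2 * M) `^ alpha * M)).
  by apply: measurable_funM; [exact: measurable_cmod_powR|exact: mF].
apply: ae_on_mono2 (cmod_powR_le (ltW al0) bF) (bF b) => x _ h1 h2.
by rewrite normrM ler_pM.
Qed.

Lemma rhs_even L alpha omega kappa F G : even_HH1 L F G ->
  forall b, ae_on L (fun x => rhs alpha omega kappa F b (L - x) = rhs alpha omega kappa F b x).
Proof.
move=> a b.
have e c : ae_on L (fun x => F c (L - x) = F c x).
  by have [p _ _ ev] := a c; exact: even_ae_on.
apply: ae_on_mono2 (e true) (e false) => x _ h1 h2.
by rewrite /rhs /cmod h1 h2; case: b; rewrite ?h1 ?h2.
Qed.

(** Even test functions suffice: the odd part of a test function contributes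
    nothing to either side. *)
Lemma wderiv_even_test L (g w : R -> R) : L2per L g -> L2per L w ->
  ae_on L (fun x => g (L - x) = - g x) -> ae_on L (fun x => w (L - x) = w x) ->
  (forall phi, testC1per L phi -> (forall x, phi (- x) = phi x) ->
     ip L g (derive1 phi) = - ip L w phi) ->
  is_wderiv L g w.
Proof.
move=> lg lw go we H; split => // phi tphi; have [pp _ _] := tphi.
have lp : L2per L phi by apply: continuous_L2per; exact: testC1per_continuous tphi.
have ldp : L2per L (derive1 phi) by apply: continuous_L2per; case: tphi.
have [tr dr] := test_refl tphi.
have lr := L2per_refl lp; have ldr := L2per_refl ldp.
pose phie x := phi x + phi (L - x).
have dphie x : is_derive x 1 phie (derive1 phi x - derive1 phi (L - x)).
  apply: is_deriveD; first exact: testC1per_is_derive tphi _.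
  by have := testC1per_is_derive tr x; rewrite dr.
have te : testC1per L phie.
  apply: (testC1per_primitive _ dphie); last first.
    by have [pr _ _] := tr; move=> x; rewrite /phie pp; congr (_ + _); exact: pr.
  have [_ _ cdr] := tr; rewrite dr in cdr; have [_ _ cdp] := tphi.
  exact: cont_add.
have ev x : phie (- x) = phie x.
  by rewrite /phie opprK (addrC L x) pp (addrC L (- x)) pp addrC.
have := H _ te ev; rewrite (is_derive_derive1 dphie).
have -> : ip L g (fun x => derive1 phi x - derive1 phi (L - x)) = 2 * ip L g (derive1 phi).
  have -> : ip L g (fun x => derive1 phi x - derive1 phi (L - x)) =
      ip L g (derive1 phi) + ip L g (fun x => (-1) * derive1 phi (L - x)).
    rewrite -ipDr //; last exact: L2perZ.
    by apply: eq_Rint => x _; rewrite mulN1r.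
  have -> : ip L g (fun x => (-1) * derive1 phi (L - x)) = ip L g (derive1 phi).
    rewrite (ipZr (-1) ldr lg).
    rewrite mulN1r -(ip_refl lg ldr).
    have lgr := L2per_refl lg; have ldrr := L2per_refl ldr.
    have -> : ip L (fun x => g (L - x)) (fun x => derive1 phi (L - (L - x))) =
        ip L (fun x => - g x) (derive1 phi).
      have lng : L2per L (fun x => - g x).
        by have := L2perZ (-1) lg; congr (L2per _ _); apply/funext => x; rewrite mulN1r.
      apply: (eq_ae_ip lgr lng ldrr ldp go).
      by apply: ae_on_all => x _; rewrite subKr.
    have -> : ip L (fun x => - g x) (derive1 phi) = - ip L g (derive1 phi).
      rewrite -mulN1r -(ipZl (-1) lg ldp).
      by apply: eq_Rint => x _; rewrite mulN1r.
    by rewrite opprK.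
  by rewrite mulr_natl mulr2n.
have -> : ip L w phie = 2 * ip L w phi.
  rewrite /phie ipDr //.
  have -> : ip L w (fun x => phi (L - x)) = ip L w phi.
    rewrite -(ip_refl lw lr); apply: eq_ae_ip => //; [exact: L2per_refl|exact: (L2per_refl lr)|].
    by apply: ae_on_all => x _; rewrite subKr.
  by rewrite mulr_natl mulr2n.
rewrite -mulrN => /(mulfI _); apply; by rewrite pnatr_eq0.
Qed.

Lemma minimizer_weak_eq L alpha omega tau F G : 0 < L -> 0 < alpha -> 0 < omega -> 0 < tau ->
  even_HH1 L F G -> mass L alpha F = tau -> energy L omega F G = min_energy L alpha omega tau ->
  forall b, is_wderiv L (G b) (rhs alpha omega (2 * min_energy L alpha omega tau / tau) F b).
Proof.
move=> L0 al0 o0 t0 a NF EF b; set kappa := 2 * _ / tau.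
have [pf lf wf ef] := a b; have lg : L2per L (G b) by case: wf.
apply: wderiv_even_test => //.
- exact: (rhs_L2 _ _ L0 al0 a b).
- by apply: (wderiv_odd L0 lf wf); exact: even_ae_on.
- exact: (rhs_even _ _ _ a b).
move=> phi tphi ephi; have [pp _ cdp] := tphi.
have lp : L2per L phi by apply: continuous_L2per; exact: testC1per_continuous tphi.
have ldp : L2per L (derive1 phi) by exact: continuous_L2per.
pose F' c := if c == b then phi else (fun=> 0).
pose G' c := if c == b then derive1 phi else (fun=> 0).
have a' : even_HH1 L F' G'.
  move=> c; rewrite /F' /G'; case: eqP => _; last exact: even_H1_cst.
  by split => //; [exact: is_wderiv_C1|exact: aeW].
have := minimizer_variation L0 al0 o0 t0 a NF EF a'; rewrite -/kappa.
have ip0 (k : R -> R) : ip L k (fun=> 0) = 0.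
  by rewrite /ip; under eq_Rintegral do rewrite mulr0; rewrite Rint_cst // mul0r.
have -> : energy_form L omega F G F' G' = ip L (G b) (derive1 phi) + omega * ip L (F b) phi.
  by rewrite /energy_form /F' /G'; case: (b); rewrite /= !ip0 ?addr0 ?add0r.
have [M bF] := even_HH1_bounded L0 a; have mF := even_HH1_measurable a.
pose h x := cmod F x `^ alpha * F b x.
have lh : L2per L h.
  apply: (@L2per_bounded _ _ _ ((2 * M) `^ alpha * M)).
    by apply: measurable_funM; [exact: measurable_cmod_powR|exact: mF].
  apply: ae_on_mono2 (cmod_powR_le (ltW al0) bF) (bF b) => x _ h1 h2.
  by rewrite normrM ler_pM.
have -> : mass_form L alpha F F' = ip L h phi.
  apply: eq_Rint => x _; rewrite /F' /h.
  by case: (b); rewrite /= mulr0 ?addr0 ?add0r mulrA.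
have -> : ip L (rhs alpha omega kappa F b) phi = omega * ip L (F b) phi - kappa * ip L h phi.
  rewrite -[- (kappa * _)]mulN1r mulrA -!ipZl // -ipDl //; try exact: L2perZ.
  by apply: eq_Rint => x _; rewrite /rhs /h; ring.
move: (ip _ _ _) (ip _ (F b) _) (ip _ h _) => A1 A2 A3; clear; lra.
Qed.

End EulerLagrange.

(** * Regularity of weak solutions *)

Section Regularity.
Context {R : realType}.
Local Open Scope classical_set_scope.
Notation mu := (@lebesgue_measure R).
Implicit Types (L x y M e t alpha omega kappa tau : R) (F G : bool -> R -> R).

(** At a zero of [m] the power may fail to be differentiable; there [alpha > 0]
    makes it tend to [0]. *)
Lemma continuous_powR_pos alpha (m : R -> R) : 0 < alpha -> (forall x, 0 <= m x) ->
  continuous m -> continuous (fun x => m x `^ alpha).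
Proof.
move=> al0 m0 cm x; have := m0 x; rewrite le_eqVlt => /predU1P[mx|mx].
  apply/cvgrPdist_lt => e e0; rewrite -mx powR0 ?gt_eqF //.
  have d0 : 0 < e `^ alpha^-1 by exact: powR_gt0.
  have /cvgrPdist_lt/(_ _ d0) := cm x; apply: filterS => y; rewrite -mx !sub0r !normrN.
  rewrite !ger0_norm ?powR_ge0 // => H.
  have an0 : alpha != 0 by rewrite gt_eqF.
  rewrite -[X in _ < X](powRr1 (ltW e0)) -(mulVf an0) powRrM.
  by apply: gt0_ltr_powR; rewrite ?nnegrE ?powR_ge0.
apply: (@continuous_comp _ _ _ m (fun y => y `^ alpha)); first exact: cm.
apply/differentiable_continuous/derivable1_diffP.
by have [] := is_derive1_powR alpha mx.
Qed.

Lemma continuous_cmod F : (forall b, continuous (F b)) -> continuous (cmod F).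
Proof.
move=> cF x; rewrite /cmod /hypot.
apply: (@continuous_comp _ _ _ (fun x => F true x ^+ 2 + F false x ^+ 2) Num.sqrt).
  by apply: cont_add => y; apply: cont_mul; exact: cF.
exact: sqrt_continuous.
Qed.

Lemma rhs_continuous alpha omega kappa F b : 0 < alpha -> (forall b, continuous (F b)) ->
  continuous (rhs alpha omega kappa F b).
Proof.
move=> al0 cF x; rewrite /rhs.
have c1 : continuous (fun y => cmod F y `^ alpha * F b y).
  apply: cont_mul => //; apply: continuous_powR_pos => //; last exact: continuous_cmod.
  by move=> y; exact: hypot_ge0.
by apply: cvgB; apply: cvgMl_tmp; [exact: cF|exact: c1].
Qed.

Lemma eq_ae_prim L f g x : L1per L f -> L1per L g -> ae_on L (fun x => f x = g x) ->
  0 <= x <= L -> prim f x = prim g x.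
Proof.
move=> lf lg fg /andP[x0 xL]; apply: eq_ae_Rint.
- by apply: L1per_meas; exact: L1perS xL lf.
- by apply: L1per_meas; exact: L1perS xL lg.
apply: ae_mono fg => y H /=; rewrite in_itv /= => /andP[y0 yx]; apply: H.
by rewrite /= in_itv /= y0 (le_trans yx).
Qed.

Lemma is_derive_cstD (c : R) (H : R -> R) h x : is_derive x 1 H h ->
  is_derive x 1 (fun y => c + H y) h.
Proof. by move=> dH; rewrite -[h]add0r; exact: is_deriveD. Qed.

(** Bootstrapping: the representative of [F] given by a primitive of [G] is
    continuous, so the right-hand side is, so [G] is C^1 and [F] is C^2. The
    vanishing means of [G] and of the right-hand side keep the successive
    primitives periodic, so that identities on a period extend to the line. *)
Lemma regularity L alpha omega kappa F G : 0 < L -> 0 < alpha -> even_HH1 L F G ->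
  (forall b, is_wderiv L (G b) (rhs alpha omega kappa F b)) ->
  exists V V' : bool -> R -> R,
    [/\ forall b x, is_derive x 1 (V b) (V' b x),
        forall b x, is_derive x 1 (V' b) (rhs alpha omega kappa V b x) &
        forall b, {ae mu, forall x, F b x = V b x}].
Proof.
move=> L0 al0 a wG.
have L00 : 0 <= (0:R) <= L by rewrite lexx ltW.
have LL : 0 <= L <= L by rewrite lexx ltW.
have /choice[C FE] : forall b, exists C, ae_on L (fun x => F b x = C + prim (G b) x).
  by move=> b; have [_ lf wf _] := a b; exact: wderiv_rep wf.
have lG b : L1per L (G b) by have [_ _ /wderiv_L1] := a b.
have GL b : prim (G b) L = 0 by have [_ _ /wderiv_int0] := a b.
pose W b x := C b + prim (G b) x.
have WL b : W b L = W b 0 by rewrite /W GL prim0.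
have cW b : {within `[0, L], continuous (W b)}.
  move=> x; apply: cvgD; first exact: cvg_cst.
  exact: (prim_within_continuous (ltW L0) (lG b)).
pose V b := periodize L (W b).
have pV b : periodic (V b) L by exact: periodize_periodic.
have cV b : continuous (V b) by exact: periodize_continuous.
have FV b : ae_on L (fun x => F b x = V b x).
  by apply: ae_on_mono (FE b) => x xL ->; rewrite /V periodizeE.
pose w b := rhs alpha omega kappa V b.
have cw b : continuous (w b) by exact: rhs_continuous.
have pw b : periodic (w b) L by move=> x; rewrite /w /rhs /cmod !pV.
have Fw b : ae_on L (fun x => rhs alpha omega kappa F b x = w b x).
  by apply: ae_on_mono2 (FV true) (FV false) => x _ h1 h2; rewrite /w /rhs /cmod h1 h2; case: b; rewrite ?h1 ?h2.
have /choice[H HE] : forall b, exists H, H 0 = 0 /\ forall x, is_derive x 1 H (w b x).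
  by move=> b; exact: primitive_exists.
have /choice[c GE] : forall b, exists c, ae_on L (fun x => G b x = c + prim (rhs alpha omega kappa F b) x).
  by move=> b; apply: wderiv_rep (wG b) => //; have [_ _ []] := a b.
have primH b x : 0 <= x <= L -> prim (rhs alpha omega kappa F b) x = H b x.
  move=> xL; have [H0 dH] := HE b.
  rewrite (eq_ae_prim (wderiv_L1 (wG b)) (continuous_L1per L (cw b)) (Fw b) xL).
  by rewrite /prim (FTC2_Rint (cw b) dH) ?H0 ?subr0 //; case/andP: xL.
pose V' b x := c b + H b x.
have GV' b : ae_on L (fun x => G b x = V' b x).
  by apply: ae_on_mono (GE b) => x xL ->; rewrite primH.
have dV' b x : is_derive x 1 (V' b) (w b x).
  by apply: is_derive_cstD; have [_ dH] := HE b; exact: dH.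
have pV' b : periodic (V' b) L.
  apply: (periodic_primitive (pw b) (dV' b)).
  by rewrite /V' -(primH _ _ LL) -(primH _ _ L00) (wderiv_int0 (wG b)) prim0.
have cV' b : continuous (V' b) by apply: is_derive_continuous (dV' b).
have /choice[P PE] : forall b, exists P, P 0 = 0 /\ forall x, is_derive x 1 P (V' b x).
  by move=> b; exact: primitive_exists.
have primP b x : 0 <= x <= L -> prim (G b) x = P b x.
  move=> xL; have [P0 dP] := PE b.
  rewrite (eq_ae_prim (lG b) (continuous_L1per L (cV' b)) (GV' b) xL).
  by rewrite /prim (FTC2_Rint (cV' b) dP) ?P0 ?subr0 //; case/andP: xL.
have pP b : periodic (P b) L.
  have [P0 dP] := PE b; apply: (periodic_primitive (pV' b) dP).
  by rewrite -(primP _ _ LL) -(primP _ _ L00) GL prim0.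
have VE b : V b = (fun x => C b + P b x).
  apply/funext => x; rewrite /V /periodize /W (periodic_wrap x (pP b)) primP //.
  by have /andP[-> /ltW] := wrap_itv x L0.
exists V, V'; split => // b.
- by move=> x; rewrite VE; apply: is_derive_cstD; have [_ dP] := PE b; exact: dP.
- by have [pf _ _ _] := a b; apply: ae_periodic L0 pf (pV b) (FV b).
Qed.

End Regularity.

(** * The Lagrange multiplier as a function of the level *)

Section Multiplier.
Context {R : realType}.
Local Open Scope classical_set_scope.
Notation mu := (@lebesgue_measure R).
Implicit Types (L x y M e t c alpha omega kappa tau : R) (F G : bool -> R -> R).

(** Scale a minimizer for one inequality; the other is [min_energy_homog]. *)
Lemma min_energy_scale L alpha omega tau c : 0 < L -> 0 < alpha -> 0 < omega -> 0 < tau -> 0 < c ->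
  min_energy L alpha omega (c `^ (alpha + 2) * tau) = c ^+ 2 * min_energy L alpha omega tau.
Proof.
move=> L0 al0 o0 t0 c0; apply/eqP; rewrite eq_le; apply/andP; split.
  have [F [G [a NF EF]]] := exists_minimizer L0 al0 o0 t0.
  rewrite -EF -energy_scale //; apply: min_energy_le; first exact: ltW.
    exact: even_HH1_scale.
  by rewrite (mass_scale (ltW c0) (L1per_mass L0 al0 a)) NF.
have t1 : 0 < c `^ (alpha + 2) * tau by rewrite mulr_gt0 // powR_gt0.
have [F [G [a NF <-]]] := exists_minimizer L0 al0 o0 t1.
by apply: min_energy_homog => //; [exact: ltW|rewrite NF].
Qed.

(** A pair of zero energy vanishes, hence has no mass. *)
Lemma min_energy_gt0 L alpha omega tau : 0 < L -> 0 < alpha -> 0 < omega -> 0 < tau ->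
  0 < min_energy L alpha omega tau.
Proof.
move=> L0 al0 o0 t0; rewrite lt_neqAle min_energy_ge0 ?andbT //; last exact: ltW.
apply/eqP => G0; have [F [G [a NF]]] := exists_minimizer L0 al0 o0 t0.
rewrite -G0 => E0; have mF := even_HH1_measurable a.
have b0 : bounded2 L F 0.
  move=> b; have [] := energy_ip_le L F G b o0; rewrite E0 !mulr0 => g0 f0.
  apply: ae_on_mono (even_H1_bounded L0 (a b)) => x _ /le_trans; apply.
  have -> : ip L (F b) (F b) = 0 by apply/eqP; rewrite eq_le f0 ip_ge0.
  have -> : ip L (G b) (G b) = 0 by apply/eqP; rewrite eq_le g0 ip_ge0.
  by rewrite !mulr0 addr0 sqrtr0.
have p0 : 0 < alpha + 2 by lra.
have N0 : mass L alpha F = 0.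
  transitivity (\int[mu]_(x in `[0, L]) (0 : R)); last by rewrite Rint_cst // mul0r.
  apply: eq_ae_Rint; [exact: measurable_cmod_powR|exact: measurable_cst|].
  apply: ae_on_mono (cmod_powR_le (ltW p0) b0) => x _; rewrite mulr0 powR0 ?gt_eqF //.
  by rewrite ger0_norm ?powR_ge0 // => h; apply/eqP; rewrite eq_le h powR_ge0.
by move: t0; rewrite -NF N0 ltxx.
Qed.

(** By homogeneity the multiplier [2 min_energy / tau] is a constant times
    [tau `^ (- alpha / (alpha + 2))], so it equals one exactly once. *)
Lemma multiplier_one L alpha omega : 0 < L -> 0 < alpha -> 0 < omega ->
  exists2 tau0 : R, 0 < tau0 &
    forall tau, 0 < tau -> (2 * min_energy L alpha omega tau / tau = 1 <-> tau = tau0).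
Proof.
move=> L0 al0 o0; set g := min_energy L alpha omega 1.
have g0 : 0 < 2 * g by rewrite mulr_gt0 // min_energy_gt0.
pose p := alpha + 2; have p0 : 0 < p by rewrite /p; lra.
have pn0 : p != 0 by rewrite gt_eqF.
have an0 : alpha != 0 by rewrite gt_eqF.
have en0 : alpha / p * (p / alpha) = 1 by field; apply/andP; split.
exists ((2 * g) `^ (p / alpha)); first exact: powR_gt0.
move=> tau t0; have tn0 : tau != 0 by rewrite gt_eqF.
have tp : (tau `^ p^-1) `^ p = tau by rewrite -powRrM mulVf // powRr1 // ltW.
have GE : min_energy L alpha omega tau = (tau `^ p^-1) ^+ 2 * g.
  by rewrite -min_energy_scale ?powR_gt0 // mulr1 tp.
have tE : tau = (tau `^ p^-1) ^+ 2 * tau `^ (alpha / p).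
  rewrite -powR_mulrn ?powR_ge0 // -powRrM -powRD; last by rewrite tn0 implybT.
  by rewrite [X in _ `^ X](_ : _ = 1) ?powRr1 ?ltW // /p; field.
have q0 : (tau `^ p^-1) ^+ 2 != 0 by rewrite expf_neq0 // gt_eqF // powR_gt0.
have y0 : tau `^ (alpha / p) != 0 by rewrite gt_eqF // powR_gt0.
have -> : 2 * min_energy L alpha omega tau / tau = 2 * g / tau `^ (alpha / p).
  rewrite GE [X in _ / X]tE; move: q0 y0.
  move: (_ ^+ 2) (tau `^ (alpha / p)) => X Y X0 Y0; clear -X0 Y0.
  by field; apply/andP; split.
split=> [/divr1_eq ->|->]; first by rewrite -powRrM en0 powRr1 // ltW.
by rewrite -powRrM (mulrC (p / alpha)) en0 powRr1 ?(ltW g0) // divff // gt_eqF.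
Qed.

End Multiplier.

(** * Complex-valued minimizers and classical solutions *)

Section Complex.
Context {R : realType}.
Local Open Scope classical_set_scope.
Notation mu := (@lebesgue_measure R).
Implicit Types (L x y M e t c alpha omega kappa tau : R) (F G : bool -> R -> R) (u : R -> R[i]).

Lemma is_minimizerP L alpha tau omega u : 0 < L ->
  is_minimizer L alpha tau omega u <-> exists G,
    [/\ even_HH1 L (parts u) G, mass L alpha (parts u) = tau &
        energy L omega (parts u) G = min_energy L alpha omega tau].
Proof.
move=> L0; rewrite /is_minimizer Gamma_inf //; split.
  move=> [/Y_parts[[G a] NF] BE]; exists G; split => //.
  by rewrite -(B_energy omega L0 a).
move=> [G [a NF EF]]; split; first by apply/Y_parts; split => //; exists G.
by rewrite (B_energy omega L0 a).
Qed.

Lemma derive1_eq_on L (f g : R -> R) d x : 0 < x < L ->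
  (forall y, 0 < y < L -> f y = g y) -> is_derive x 1 g d -> derive1 f x = d.
Proof.
move=> xL fg dg.
have df : is_derive x 1 f d.
  apply: (@near_eq_is_derive _ _ _ g) => //.
  have : \forall y \near x, y \in (`]0, L[)%R by apply: near_in_itvoo; rewrite in_itv.
  by apply: filterS => y; rewrite in_itv /= => /fg.
by rewrite derive1E; have [] := df.
Qed.

Lemma complex_equation alpha omega (v : R -> R[i]) x :
  - cderiv (cderiv v) x + omega%:C * v x
    - (ComplexField.Normc.normc (v x) `^ alpha)%:C * v x = 0 ->
  forall b, derive1 (derive1 (parts v b)) x =
    omega * parts v b x - cmod (parts v) x `^ alpha * parts v b x.
Proof.
rewrite normc_cmod; set m := cmod _ _ `^ _.
have -> : cderiv (cderiv v) x =
  derive1 (derive1 (parts v true)) x +i* derive1 (derive1 (parts v false)) x by [].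
have vE : v x = parts v true x +i* parts v false x.
  by rewrite /parts /re_part /im_part; case: (v x).
rewrite vE => /eqP; rewrite eq_complex /= => /andP[/eqP e1 /eqP e2] [].
  by move: e1; rewrite /parts /=; move: (derive1 _ x) (re_part v x) (im_part v x) => d r i; clear; lra.
by move: e2; rewrite /parts /=; move: (derive1 _ x) (re_part v x) (im_part v x) => d r i; clear; lra.
Qed.

(** For [kappa = 1] the representative of [regularity] is a classical solution.
    Conversely a classical solution coincides with that representative on the
    period, and comparing the two second derivatives there leaves
    [(1 - kappa) |u|^alpha u = 0], while [u] has positive mass. *)
Lemma solves_multiplier L alpha omega tau kappa u G :
  0 < L -> 0 < alpha -> 0 < tau ->
  even_HH1 L (parts u) G -> mass L alpha (parts u) = tau ->
  (forall b, is_wderiv L (G b) (rhs alpha omega kappa (parts u) b)) ->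
  (solves alpha omega u <-> kappa = 1).
Proof.
move=> L0 al0 t0 a NF wG.
have [V [V' [dV dV' FV]]] := regularity L0 al0 a wG.
have cV b : continuous (V b) by apply: is_derive_continuous (dV b).
split=> [[v [uv dv dv' eqv]]|k1]; last first.
  have ED F F' : (forall b x, is_derive x 1 (F b) (F' b x)) ->
      cderivable (of_parts F) /\ cderiv (of_parts F) = of_parts F'.
    move=> dF; split.
      by move=> x; split; [have [] := dF true x|have [] := dF false x].
    apply/funext => x; rewrite /cderiv /of_parts.
    by rewrite (is_derive_derive1 (dF true)) (is_derive_derive1 (dF false)).
  have [c1 e1] := ED _ _ dV; have [c2 e2] := ED _ _ dV'.
  exists (of_parts V); split; [|exact: c1|by rewrite e1|]; last first.
  - move=> x; rewrite e1 e2 normc_cmod of_partsK /of_parts /rhs k1.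
    by apply/eqP; rewrite eq_complex /=; apply/andP; split; apply/eqP; ring.
  apply: ae_mono2 (FV true) (FV false) => x; rewrite /= /re_part /im_part /of_parts => <- <-.
  by case: (u x).
have dvb b x : derivable (parts v b) x 1.
  by case: b; [exact: (dv x).1|exact: (dv x).2].
have cv b : continuous (parts v b).
  by move=> x; apply/differentiable_continuous/derivable1_diffP.
have vV b x : 0 <= x <= L -> parts v b x = V b x.
  move=> xL; apply/eqP; rewrite -subr_eq0; apply/eqP.
  apply: (@within_continuous_eq0 _ L (fun y => parts v b y - V b y) L0 _ _ x xL).
    by apply: continuous_subspaceT => y; apply: cvgB; [exact: cv|exact: cV].
  apply: ae_mono2 uv (FV b) => y uy Fy _; rewrite -Fy.
  by case: (b); rewrite /parts /re_part /im_part uy subrr.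
have [->//|k1] := eqVneq kappa 1; exfalso.
have v0 b x : 0 < x < L -> cmod V x `^ alpha * V b x = 0.
  move=> xL; have i y : 0 < y < L -> 0 <= y <= L by move=> /andP[/ltW-> /ltW].
  have e1 y : 0 < y < L -> derive1 (parts v b) y = V' b y.
    by move=> yL; apply: derive1_eq_on yL _ (dV b y) => z /i/vV.
  have e2 : derive1 (derive1 (parts v b)) x = rhs alpha omega kappa V b x.
    exact: derive1_eq_on xL e1 (dV' b x).
  have := complex_equation (eqv x) b; rewrite e2 /rhs.
  have -> : cmod (parts v) x = cmod V x by rewrite /cmod !vV ?i.
  rewrite vV ?i // => /eqP; rewrite -subr_eq0.
  have k10 : 1 - kappa != 0 by rewrite subr_eq0 eq_sym.
  move=> /eqP h; apply: (mulfI k10); rewrite mulr0 -[RHS]h; ring.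
have V0 b x : 0 < x < L -> V b x = 0.
  move=> xL; have /eqP := v0 b x xL; rewrite mulf_eq0 => /orP[|/eqP//].
  rewrite powR_eq0 => /andP[/eqP m0 _].
  have := sqr_hypot (V true x) (V false x); rewrite -/(cmod V x) m0 expr0n /= => /eqP.
  rewrite eq_sym paddr_eq0 ?sqr_ge0 // !sqrf_eq0 => /andP[/eqP h1 /eqP h2].
  by case: b.
have p0 : alpha + 2 != 0 by rewrite gt_eqF //; lra.
move: t0; rewrite -NF; suff -> : mass L alpha (parts u) = 0 by rewrite ltxx.
transitivity (\int[mu]_(x in `[0, L]) (0 : R)); last by rewrite Rint_cst // mul0r.
have mF := even_HH1_measurable a.
apply: eq_ae_Rint; [exact: measurable_cmod_powR|exact: measurable_cst|].
apply: ae_on_open.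
apply: ae_mono2 (FV true) (FV false) => x h1 h2 _ xL.
by rewrite /cmod h1 h2 !V0 // /hypot expr0n /= addr0 sqrtr0 powR0.
Qed.

Lemma minimizer_scale L alpha omega tau c u : 0 < L -> 0 < alpha -> 0 < omega -> 0 < tau -> 0 < c ->
  is_minimizer L alpha tau omega u ->
  is_minimizer L alpha (c `^ (alpha + 2) * tau) omega (fun x => c%:C * u x).
Proof.
move=> L0 al0 o0 t0 c0 /(is_minimizerP _ _ _ _ L0)[G [a NF EF]].
have E : parts (fun x => c%:C * u x) = (fun b x => c * parts u b x).
  apply/funext => b; apply/funext => x; rewrite /parts /re_part /im_part.
  by case: b; case: (u x) => s t /=; rewrite mul0r ?subr0 ?addr0.
apply/(is_minimizerP _ _ _ _ L0); exists (fun b x => c * G b x); rewrite E.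
split; first exact: even_HH1_scale.
- by rewrite (mass_scale (ltW c0) (L1per_mass L0 al0 a)) NF.
- by rewrite energy_scale // EF min_energy_scale.
Qed.

Lemma minimizer_solves L alpha omega tau u : 0 < L -> 0 < alpha -> 0 < omega -> 0 < tau ->
  is_minimizer L alpha tau omega u ->
  (solves alpha omega u <-> 2 * min_energy L alpha omega tau / tau = 1).
Proof.
move=> L0 al0 o0 t0 /(is_minimizerP _ _ _ _ L0)[G [a NF EF]].
exact: (solves_multiplier L0 al0 t0 a NF (minimizer_weak_eq L0 al0 o0 t0 a NF EF)).
Qed.

End Complex.

Theorem proposition2p1 (R : realType) (L alpha : R)
    (hL : 0 < L) (halpha : 0 < alpha) (omega : R) (homega : 0 < omega) :
  exists2 tau0 : R, 0 < tau0 &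
    forall tau : R, 0 < tau ->
      (exists Phi : R -> R[i],
          Y L alpha tau Phi /\ B L omega Phi = Gamma L alpha tau omega) /\
      (forall Phi : R -> R[i], is_minimizer L alpha tau omega Phi ->
          (exists2 c : R, 0 < c &
             let Psi := fun x => c%:C * Phi x in
             is_minimizer L alpha (c `^ (alpha + 2) * tau) omega Psi /\
             solves alpha omega Psi) /\
          (solves alpha omega Phi <-> tau = tau0)).
Proof.
have [tau0 tau00 kappa1] := multiplier_one hL halpha homega.
exists tau0 => // tau t0; split.
  have [F [G [a NF EF]]] := exists_minimizer hL halpha homega t0.
  exists (of_parts F); apply/(is_minimizerP _ _ _ _ hL); rewrite of_partsK.
  by exists G.
move=> Phi minPhi; split; last first.
  apply: iff_trans (minimizer_solves hL halpha homega t0 minPhi) _.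
  exact: kappa1.
have p0 : alpha + 2 != 0 by rewrite gt_eqF //; lra.
pose c := (tau0 / tau) `^ (alpha + 2)^-1.
have c0 : 0 < c by rewrite powR_gt0 // divr_gt0.
have ct : c `^ (alpha + 2) * tau = tau0.
  by rewrite -powRrM mulVf // powRr1 ?ltW ?divr_gt0 // divfK // gt_eqF.
exists c => // Psi; have minPsi := minimizer_scale hL halpha homega t0 c0 minPhi.
split => //; rewrite ct in minPsi.
by apply/(minimizer_solves hL halpha homega tau00 minPsi)/kappa1.
Qed.
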